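(* Let $p,e>2$ be primes and let $H=H(\mathbb{F}_{p^e})$ be the Heisenberg group over the field with $p^e$ elements. The subgroups $N\leq H'$ with $|H:N|=p^{2e+2}$ are normal in $H$; all the quotients $H/N$, for such $N$, have the same subgroup profile and the same quotient-group profile; and each satisfies $d(H/N)=2e$. Yet the set $$\mathcal{G}_{p,e}=\{H/N : N\leq H',\ |H:N|=p^{2e+2}\}$$ contains at least $p^{e-3}/e$ isomorphism classes of groups.
   Context: All groups are finite. The Heisenberg group over $\mathbb{F}_{p^e}$ is $$H(\mathbb{F}_{p^e})=\left\{\begin{bmatrix}1&\alpha&\gamma\\0&1&\beta\\0&0&1\end{bmatrix}:\alpha,\beta,\gamma\in\mathbb{F}_{p^e}\right\}$$ under matrix multiplication, and $H'=[H,H]$ is its commutator subgroup. For a group $G$, $d(G)$ is the minimal number of generators of $G$. The subgroup profile of a group $G$ is the partition of the proper subgroups of $G$ into isomorphism classes. Two groups $G_1,G_2$ have the same subgroup profile if they have equal multisets of isomorphism types of proper subgroups, i.e. for every group $J$ the number of proper subgroups of $G_1$ isomorphic to $J$ equals the number of proper subgroups of $G_2$ isomorphic to $J$. The quotient-group profile is defined likewise with proper quotient groups: $G_1,G_2$ have the same quotient-group profile if for every group $J$ the number of nontrivial normal subgroups $K$ of $G_1$ with $G_1/K\cong J$ equals the number of nontrivial normal subgroups $K$ of $G_2$ with $G_2/K\cong J$. *)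

(* Defs.v *)
From HB Require Import structures.
From mathcomp Require Import all_boot all_order all_algebra.
From mathcomp Require Import all_fingroup all_solvable.
Set Implicit Arguments.
Unset Strict Implicit.
Unset Printing Implicit Defensive.
Import GroupScope GRing.Theory.

Section Heisenberg.
Variable F : finFieldType.
Local Open Scope ring_scope.

Definition heis_mx (a b c : F) : 'M[F]_3 :=
  \matrix_(i, j) nth 0 (nth [::] [:: [:: 1; a; c];
                                     [:: 0; 1; b];
                                     [:: 0; 0; 1]] i) j.

Definition heis : {set {'GL_3[F]}} :=
  [set g : {'GL_3[F]} | [exists a, exists b, exists c, GLval g == heis_mx a b c]].

Lemma heis_mx1 : heis_mx 0 0 0 = 1%:M.
Proof.
by apply/matrixP=> -[[|[|[|i]]] Hi] -[[|[|[|j]]] Hj] //; rewrite !mxE.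
Qed.

Lemma heis_mxM a b c a' b' c' :
  heis_mx a b c *m heis_mx a' b' c' = heis_mx (a + a') (b + b') (c + c' + a * b').
Proof.
apply/matrixP=> -[[|[|[|i]]] Hi] -[[|[|[|j]]] Hj] //;
  rewrite !mxE !big_ord_recl big_ord0 !mxE /=;
  rewrite ?(mulr0, mul0r, mulr1, mul1r, addr0, add0r) //.
- by rewrite addrC.
- by rewrite [_ + c]addrC addrA [c' + _]addrC.
- by rewrite addrC.
Qed.

Lemma heisP (g : {'GL_3[F]}) :
  reflect (exists a b c, GLval g = heis_mx a b c) (g \in heis).
Proof.
rewrite inE; apply: (iffP existsP) => [[a /existsP[b /existsP[c /eqP Eg]]]|].
  by exists a, b, c.
move=> [a [b [c Eg]]]; exists a; apply/existsP; exists b; apply/existsP.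
by exists c; apply/eqP.
Qed.

Lemma heis_group_set : group_set heis.
Proof.
apply/group_setP; split=> [|g h /heisP[a [b [c Eg]]] /heisP[a' [b' [c' Eh]]]].
  by apply/heisP; exists 0, 0, 0; rewrite heis_mx1.
apply/heisP; exists (a + a'), (b + b'), (c + c' + a * b').
by rewrite -heis_mxM -Eg -Eh.
Qed.

Canonical heis_group := Group heis_group_set.

End Heisenberg.

Definition same_subgroup_profile (gT1 gT2 : finGroupType)
    (G1 : {group gT1}) (G2 : {group gT2}) : Prop :=
  forall (rT : finGroupType) (J : {group rT}),
    #|[set K : {group gT1} | (K \proper G1) && (K \isog J)]|
    = #|[set K : {group gT2} | (K \proper G2) && (K \isog J)]|.

Definition same_quotient_profile (gT1 gT2 : finGroupType)
    (G1 : {group gT1}) (G2 : {group gT2}) : Prop :=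
  forall (rT : finGroupType) (J : {group rT}),
    #|[set K : {group gT1} | [&& K <| G1, K :!=: 1 & G1 / K \isog J]]|
    = #|[set K : {group gT2} | [&& K <| G2, K :!=: 1 & G2 / K \isog J]]|.

Definition heis_kernels (F : finFieldType) (p e : nat) :
    {set {group {'GL_3[F]}}} :=
  [set N : {group {'GL_3[F]}} |
    (N \subset [~: heis F, heis F])
    && (#|heis F : N| == (p ^ (2 * e + 2))%N)].

(* The groups heis F / N have distinct carrier types, so their isomorphism
   classes are counted as classes of the subgroups N. *)
Definition heis_iso_classes (F : finFieldType) (p e : nat) :
    {set {set {group {'GL_3[F]}}}} :=
  equivalence_partition
    (fun N1 N2 : {group {'GL_3[F]}} => heis F / N1 \isog heis F / N2)
    (heis_kernels F p e).

(* Main.v *)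
Require Import Defs.
From HB Require Import structures.
From mathcomp Require Import all_boot all_order all_algebra.
From mathcomp Require Import all_fingroup all_solvable all_field.
From mathcomp Require Import ring.
Set Implicit Arguments.
Unset Strict Implicit.
Unset Printing Implicit Defensive.
Import GroupScope GRing.Theory.

(** With [det] the determinant form on V = F^2 and N <= H' of order p^(e-2), the
    quotient H/N is the class-2 group of the bilinear map V x V -> F/N, i.e. of
    the pencil of forms lam(s det(u,v)), s in the annihilator of N, where lam is
    any nonzero F_p-functional of F.  Up to automorphisms of H the pencil is
    spanned by lam(det) and lam(w det) with w outside F_p, and as e is prime w
    generates F.

    A maximal subgroup is a hyperplane of V; all pencils become equivalent there,
    since the map q(w1) |-> q(w2) on polynomials q of degree < e intertwines
    multiplication by w1 and w2 on the hyperplane of the q of degree < e - 1.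
    Double counting pairs (K, M) with K contained in a maximal subgroup M then
    gives the subgroup profile.  Normal subgroups of H contain H' or are contained
    in it, and all H/K with |H':K| = p are isomorphic by scaling, which gives the
    quotient profile.

    An isomorphism H/N_w1 -> H/N_w2 intertwines multiplication by some
    r = t/s, with s, t in F_p + F_p w1, and multiplication by w2, so w2 is a root
    of the minimal polynomial of r: each w1 admits at most e (p^3 - p) such w2
    among the p^e - p possible ones. *)

(** * Subgroup profiles from maximal subgroups *)

Lemma maximal_sub (gT : finGroupType) (M G : {group gT}) : maximal M G -> M \subset G.
Proof. by case/maxgroupP => /proper_sub. Qed.

Definition maximals (gT : finGroupType) (G : {group gT}) : {set {group gT}} :=
  [set M : {group gT} | maximal M G].

Lemma card_maximals_injm (aT rT : finGroupType) (A : {group aT}) (f : {morphism A >-> rT}) :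
  'injm f -> #|maximals (f @* A)| = #|maximals A|.
Proof.
move=> injf; rewrite -(@card_in_imset _ _ (fun M : {group aT} => f @* M)%G (mem (maximals A))).
  apply: eq_card => M; apply/idP/imsetP => [|[L]]; rewrite !inE => maxM.
    have sM : M \subset f @* A by apply: maximal_sub.
    exists (f @*^-1 M)%G; last by apply: group_inj; rewrite /= morphpreK.
    by rewrite inE -(injm_maximal injf) ?morphpreK ?subsetIl.
  by move=> ->; rewrite (injm_maximal injf) //; apply: maximal_sub.
move=> L M; rewrite !inE => /maximal_sub sL /maximal_sub sM.
by case=> /(injm_morphim_inj injf sL sM) /group_inj.
Qed.

Lemma card_maximals_quotient (gT : finGroupType) (G L : {group gT}) : L <| G ->
  #|maximals (G / L)%G| = #|[set M in maximals G | L \subset M]|.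
Proof.
move=> nLG; rewrite -(@card_in_imset _ _ (fun M : {group gT} => M / L)%G
    (mem [set M in maximals G | L \subset M])).
  apply: eq_card => M; apply/idP/imsetP => [|[K]]; rewrite !inE => maxM.
    exists (coset L @*^-1 M)%G; last by apply: group_inj; rewrite /= cosetpreK.
    by rewrite !inE sub_cosetpre -[in X in X && _](quotientGK nLG) cosetpre_maximal maxM.
  case/andP: maxM => maxK sLK ->; rewrite quotient_maximal //.
  exact: normalS sLK (maximal_sub maxK) nLG.
move=> K M; rewrite !inE => /andP[maxK sLK] /andP[maxM sLM] [eqKM].
apply: group_inj; apply: (quotient_inj _ _ eqKM).
  exact: normalS sLK (maximal_sub maxK) nLG.
exact: normalS sLM (maximal_sub maxM) nLG.
Qed.

Section SubgroupProfile.
Variables (gT : finGroupType) (G Z : {group gT}) (p : nat).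
Hypothesis nZG : Z <| G.
Hypothesis abelGZ : p.-abelem (G / Z).
Hypothesis sZmax : forall M : {group gT}, maximal M G -> Z \subset M.

Lemma joing_center_normal (K : {group gT}) : K \subset G -> K <*> Z <| G.
Proof.
move=> sKG; apply: sub_der1_normal.
  by apply: subset_trans (joing_subr _ _); rewrite der1_min ?normal_norm ?(abelem_abelian abelGZ).
by rewrite join_subG sKG normal_sub.
Qed.

Lemma quotient_joing_abelem (K : {group gT}) :
  K \subset G -> p.-abelem (G / (K <*> Z)).
Proof.
move=> sKG; have nKZ := joing_center_normal sKG.
have : G / Z / (K <*> Z / Z) \isog G / (K <*> Z).
  by apply: third_isog => //; apply: joing_subr.
move/isog_abelem <-; apply: quotient_abelem.
exact: abelGZ.
Qed.

(** Every maximal subgroup contains [Z], so lying above [K] is the same as lying above [K <*> Z].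
    The count thus takes place in an elementary abelian quotient, where only the order matters. *)
Lemma card_maximals_above (K : {group gT}) : K \subset G ->
  #|[set M in maximals G | K \subset M]| = #|maximals (G / (K <*> Z))%G|.
Proof.
move=> sKG; rewrite card_maximals_quotient ?joing_center_normal //.
apply: eq_card => M; rewrite !inE join_subG; case maxM: (maximal M G) => //=.
by rewrite sZmax ?andbT.
Qed.

End SubgroupProfile.

Lemma card_maximals_abelem (gT1 gT2 : finGroupType) (A : {group gT1}) (B : {group gT2}) p :
  p.-abelem A -> p.-abelem B -> #|A| = #|B| -> #|maximals A| = #|maximals B|.
Proof.
move=> abelA abelB oAB; have : A \isog B by rewrite (isog_abelem_card _ abelA) abelB oAB eqxx.
by case/isogP=> f injf imf; rewrite -(card_maximals_injm injf) -(group_inj imf).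
Qed.

Lemma maximal_exists_proper (gT : finGroupType) (H G : {group gT}) :
  H \proper G -> exists2 M : {group gT}, maximal M G & H \subset M.
Proof.
move=> prH; have [HG|[M maxM sHM]] := maximal_exists (proper_sub prH); last by exists M.
by rewrite HG properxx in prH.
Qed.

(* The number of maximal subgroups above K depends only on #|K <*> Z|, so the
   pairs K \subset M are counted for a fixed isomorphism type and fixed #|K <*> Z|. *)
Lemma same_subgroup_profile_maximal (gT1 gT2 : finGroupType)
    (G1 Z1 : {group gT1}) (G2 Z2 : {group gT2}) p :
    Z1 <| G1 -> Z2 <| G2 -> p.-abelem (G1 / Z1) -> p.-abelem (G2 / Z2) -> #|G1| = #|G2| ->
    #|Z1| = #|Z2| ->
    (forall M : {group gT1}, maximal M G1 -> Z1 \subset M) ->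
    (forall M : {group gT2}, maximal M G2 -> Z2 \subset M) ->
    (forall (M1 : {group gT1}) (M2 : {group gT2}), maximal M1 G1 -> maximal M2 G2 ->
      exists f : {morphism M1 >-> gT2}, [/\ 'injm f, f @* M1 = M2 & f @* Z1 = Z2]) ->
  same_subgroup_profile G1 G2.
Proof.
move=> nZG1 nZG2 abel1 abel2 oG oZ sZ1 sZ2 isoM rT J.
pose S1 r := [set K : {group gT1} | [&& K \proper G1, K \isog J & #|K <*> Z1| == r]].
pose S2 r := [set K : {group gT2} | [&& K \proper G2, K \isog J & #|K <*> Z2| == r]].
have oMax : #|maximals G1| = #|maximals G2|.
  have eqm gT (G Z : {group gT}) : Z <| G -> (forall M : {group gT}, maximal M G -> Z \subset M) ->
      #|maximals G| = #|maximals (G / Z)%G|.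
    move=> nZ sZ; rewrite card_maximals_quotient //; apply: eq_card => M.
    by rewrite !inE; case maxM: (maximal M G) => //=; rewrite sZ.
  rewrite (eqm _ _ _ nZG1) // (eqm _ _ _ nZG2) //; apply: (card_maximals_abelem abel1 abel2).
  by rewrite /= !card_quotient ?normal_norm // -!divgS ?normal_sub // oG oZ.
suff eqS r : #|S1 r| = #|S2 r|.
  pose n := #|G1|.+1.
  have split1 : #|[set K : {group gT1} | (K \proper G1) && (K \isog J)]| = \sum_(r < n) #|S1 r|.
    rewrite -[LHS]sum1_card (partition_big (fun K : {group gT1} => inord #|K <*> Z1| : 'I_n) xpredT) //=.
    apply: eq_bigr => r _; rewrite -[RHS]sum1_card; apply: eq_bigl => K; rewrite !inE -andbA.
    case prK: (K \proper G1) => //=; congr (_ && _); rewrite -val_eqE /= inordK //.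
    by rewrite ltnS subset_leq_card // join_subG (proper_sub prK) normal_sub.
  have split2 : #|[set K : {group gT2} | (K \proper G2) && (K \isog J)]| = \sum_(r < n) #|S2 r|.
    rewrite -[LHS]sum1_card (partition_big (fun K : {group gT2} => inord #|K <*> Z2| : 'I_n) xpredT) //=.
    apply: eq_bigr => r _; rewrite -[RHS]sum1_card; apply: eq_bigl => K; rewrite !inE -andbA.
    case prK: (K \proper G2) => //=; congr (_ && _); rewrite -val_eqE /= inordK //.
    by rewrite ltnS oG subset_leq_card // join_subG (proper_sub prK) normal_sub.
  by rewrite split1 split2; apply: eq_bigr.
(* The isomorphism [M1 -> M2] carries [Z1] to [Z2], hence respects both the type of [K] and
   [#|K <*> Z1|]. So the number of such [K] inside a maximal subgroup depends neither on that
   subgroup nor on the group. *)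
have oC (M1 : {group gT1}) (M2 : {group gT2}) : maximal M1 G1 -> maximal M2 G2 ->
    #|[set K in S1 r | K \subset M1]| = #|[set K in S2 r | K \subset M2]|.
  move=> maxM1 maxM2; have [f [injf imf fZ]] := isoM M1 M2 maxM1 maxM2.
  have prM1 := maxgroupp maxM1; have prM2 := maxgroupp maxM2.
  have S12 (K : {group gT1}) : K \subset M1 -> ((f @* K)%G \in S2 r) = (K \in S1 r).
    move=> sK; rewrite !inE -[in f @* K <*> Z2]fZ.
    have sZ1M : Z1 \subset M1 by apply: sZ1.
    rewrite -morphimY // card_injm // ?join_subG ?sK //.
    have -> : K \proper G1 by apply: sub_proper_trans prM1.
    have -> : f @* K \proper G2 by apply: sub_proper_trans prM2; rewrite -imf morphimS.
    have isoK : K \isog f @* K by apply: sub_isog.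
    rewrite /=; congr (_ && _); apply/idP/idP; first exact: isog_trans.
    by apply: isog_trans; rewrite isog_sym.
  rewrite -(@card_in_imset _ _ (fun K : {group gT1} => f @* K)%G (mem [set K in S1 r | K \subset M1])).
    apply: eq_card => K; apply/imsetP/idP => [[L LS ->]|].
      have /setIdP[S1L sL] := LS; apply/setIdP; split; first by rewrite S12.
      by rewrite -imf morphimS.
    case/setIdP=> S2K sK.
    have DK : K = (f @* (f @*^-1 K))%G by apply: group_inj; rewrite /= morphpreK ?imf.
    exists (f @*^-1 K)%G => //; apply/setIdP; split; last exact: subsetIl.
    by rewrite -S12 ?subsetIl // -DK.
  move=> K L /setIdP[_ sK] /setIdP[_ sL] [eqKL].
  exact/group_inj/(injm_morphim_inj injf sK sL eqKL).
(* Double counting of the pairs [K \subset M], by exchanging the two sums. *)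
have dbl (gT : finGroupType) (G : {group gT}) (S : {set {group gT}}) :
    \sum_(K in S) #|[set M in maximals G | K \subset M]|
    = \sum_(M in maximals G) #|[set K in S | K \subset M]|.
  transitivity (\sum_(K in S) \sum_(M in maximals G | K \subset M) 1).
    by apply: eq_bigr => K _; rewrite sum1dep_card.
  rewrite (exchange_big_dep (mem (maximals G))) /=; last by move=> K M _ /andP[].
  apply: eq_bigr => M maxM; rewrite -sum1dep_card; apply: eq_bigl => K.
  by rewrite maxM.
(* Without maximal subgroups there are no proper subgroups, and both counts vanish. *)
have [noM | ] := posnP #|maximals G1|.
  have no (gT : finGroupType) (G : {group gT}) (S : {set {group gT}}) : #|maximals G| = 0 ->
     {in S, forall K : {group gT}, K \proper G} -> #|S| = 0.
    move=> /card0_eq noMG SG; apply/eqP; rewrite cards_eq0; apply/eqP/setP => K; rewrite inE.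
    apply/idP => /SG prK; have [M maxM _] := maximal_exists_proper prK.
    by have := noMG M; rewrite inE maxM.
  have oS1 : #|S1 r| = 0 by apply: (no _ G1) => // K; rewrite inE => /and3P[].
  have oS2 : #|S2 r| = 0 by apply: (no _ G2); [rewrite -oMax | move=> K; rewrite inE => /and3P[]].
  by rewrite oS1 oS2.
move=> /card_gt0P[N1]; rewrite inE => maxN1.
have : 0 < #|maximals G2| by rewrite -oMax; apply/card_gt0P; exists N1; rewrite inE.
move=> /card_gt0P[N2]; rewrite inE => maxN2.
have eqsum : \sum_(K in S1 r) #|[set M in maximals G1 | K \subset M]|
           = \sum_(K in S2 r) #|[set M in maximals G2 | K \subset M]|.
  rewrite !dbl (eq_bigr (fun=> #|[set K in S2 r | K \subset N2]|)).
    rewrite sum_nat_const oMax -sum_nat_const; apply: eq_bigr => M; rewrite inE => maxM.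
    by rewrite -(oC N1 N2) // (oC N1 M).
  by move=> M; rewrite inE => maxM; rewrite (oC M N2).
have eqm (gT gT' : finGroupType) (G Z K : {group gT}) (G' Z' K' : {group gT'}) :
    Z <| G -> Z' <| G' -> p.-abelem (G / Z) -> p.-abelem (G' / Z') -> #|G| = #|G'| ->
    (forall M : {group gT}, maximal M G -> Z \subset M) ->
    (forall M : {group gT'}, maximal M G' -> Z' \subset M) ->
    K \proper G -> K' \proper G' -> #|K <*> Z| = r -> #|K' <*> Z'| = r ->
    #|[set M in maximals G | K \subset M]| = #|[set M in maximals G' | K' \subset M]|.
  move=> nZ nZ' abelG abelG' oGG' sZ sZ' /proper_sub sK /proper_sub sK' oK oK'.
  rewrite (card_maximals_above nZ abelG sZ sK) (card_maximals_above nZ' abelG' sZ' sK').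
  have nK := joing_center_normal nZ abelG sK; have nK' := joing_center_normal nZ' abelG' sK'.
  apply: (card_maximals_abelem (quotient_joing_abelem nZ abelG sK) (quotient_joing_abelem nZ' abelG' sK')).
  by rewrite /= !card_quotient ?normal_norm // -!divgS ?normal_sub // oK oK' oGG'.
have pos (gT : finGroupType) (G K : {group gT}) : K \proper G ->
    0 < #|[set M in maximals G | K \subset M]|.
  case/maximal_exists_proper=> M maxM sKM; apply/card_gt0P; exists M.
  by rewrite !inE maxM.
(* If [S1 r] is empty then the total number of pairs is zero on both sides; as every [K] in [S2 r]
   lies in some maximal subgroup, [S2 r] is empty too. *)
have [S0|[K0 SK0]] := set_0Vmem (S1 r).
  have [->|[K0 SK0]] := set_0Vmem (S2 r); first by rewrite S0 !cards0.
  move: eqsum; rewrite S0 big_set0 => /esym/eqP; rewrite sum_nat_eq0 => /forall_inP/(_ K0 SK0).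
  by move: SK0; rewrite inE => /and3P[/pos]; case: #|_|.
move: (SK0); rewrite inE => /and3P[prK0 _ /eqP oK0].
(* Every [K] on either side lies below the same positive number of maximal subgroups as [K0]; this
   common factor is cancelled from the equal pair counts. *)
apply/eqP; rewrite -(eqn_pmul2r (pos _ _ _ prK0)) -!sum_nat_const; apply/eqP.
transitivity (\sum_(K in S1 r) #|[set M in maximals G1 | K \subset M]|).
  by apply: eq_bigr => K; rewrite inE => /and3P[prK _ /eqP oK]; apply: (eqm _ _ _ Z1 _ _ Z1).
rewrite eqsum; apply: eq_bigr => K; rewrite inE => /and3P[prK _ /eqP oK].
by apply: (eqm _ _ _ Z2 _ _ Z1).
Qed.

Local Open Scope ring_scope.

(** * Functionals over the prime field *)

Lemma morphD0 (U V : zmodType) (f : U -> V) : {morph f : x y / x + y} -> f 0 = 0.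
Proof. by move=> fD; apply: (addrI (f 0)); rewrite -fD !addr0. Qed.

Lemma morphDN (U V : zmodType) (f : U -> V) :
  {morph f : x y / x + y} -> {morph f : x / - x}.
Proof.
by move=> fD x; apply: (addrI (f x)); rewrite -fD !subrr (morphD0 fD).
Qed.

Lemma morphDB (U V : zmodType) (f : U -> V) :
  {morph f : x y / x + y} -> {morph f : x y / x - y}.
Proof. by move=> fD x y; rewrite fD (morphDN fD). Qed.

Lemma morphDMn (U V : zmodType) (f : U -> V) :
  {morph f : x y / x + y} -> forall n, {morph f : x / x *+ n}.
Proof.
move=> fD n x; elim: n => [|n IHn]; first by rewrite !mulr0n (morphD0 fD).
by rewrite !mulrS fD IHn.
Qed.

Section PrimeVect.
Variable p : nat.
Hypothesis p_prime : prime p.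

Lemma Fp_scaleE (V : lmodType 'F_p) (a : 'F_p) (x : V) : a *: x = x *+ a.
Proof. by rewrite -scaler_nat natr_Zp. Qed.

Lemma Fp_mulrnE (a b : 'F_p) : b *+ a = a * b.
Proof. by rewrite -mulr_natl natr_Zp. Qed.

(** Scalars of the prime field act as natural multiples, so additivity already gives linearity. *)
Lemma morphD_linfun (U V : vectType 'F_p) (f : U -> V) :
  {morph f : x y / x + y} -> exists g : 'Hom(U, V), g =1 f.
Proof.
move=> fD; have fA : zmod_morphism f by apply: morphDB.
have fZ : scalable f by move=> a x; rewrite !Fp_scaleE (morphDMn fD).
pose faM := GRing.isZmodMorphism.Build _ _ f fA.
pose flM := GRing.isScalable.Build _ _ _ _ f fZ.
pose fL : {linear _ -> _} := HB.pack f faM flM.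
by exists (linfun fL) => x; rewrite lfunE.
Qed.

Lemma span_closedD (V : vectType 'F_p) (s : seq V) :
  0 \in s -> {in s &, forall x y, x + y \in s} -> <<s>>%VS =i s.
Proof.
move=> s0 sD x; apply/idP/idP => [|/memv_span //].
move/(@coord_span _ _ _ (in_tuple s))->.
elim/big_ind: _ => // i _; rewrite Fp_scaleE; move: (coord _ _ _) => /= a.
elim: {a}(a : nat) => [|n IHn]; first by rewrite mulr0n.
by rewrite mulrS sD // mem_nth.
Qed.

End PrimeVect.

(** The functionals are the coordinates of the projection along [U] onto a complement, in a basis of
    that complement; the [c j] are the basis vectors, so the two families are dual. *)
Lemma codim_functionals (K : fieldType) (E : vectType K) (U : {vspace E}) k :
  (\dim U + k = \dim {:E})%N ->
  exists mu : 'I_k -> 'Hom(E, K^o), exists2 c : 'I_k -> E,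
    forall i j, mu i (c j) = (i == j)%:R & forall x, (x \in U) = [forall i, mu i x == 0].
Proof.
move=> dimU; have dC : \dim (U^C)%VS = k by rewrite dimv_compl -dimU addKn.
case: k / dC {dimU}; set X := vbasis U^C.
have freeX : free X := basis_free (vbasisP _).
have XC j : X`_j \in (U^C)%VS.
  have [jX|jX] := ltnP j (size X); first by rewrite vbasis_mem ?mem_nth.
  by rewrite nth_default ?mem0v.
have CU0 : (U^C :&: U = 0)%VS by rewrite capvC capv_compl.
pose pi := daddv_pi (U^C)%VS U.
have kerpi x : (pi x == 0) = (x \in U).
  apply/eqP/idP => [x0|Ux].
    have := daddv_pi_add CU0 (_ : x \in _); rewrite addvC addv_complf memvf.
    by move=> /(_ isT) <-; rewrite -/(pi x) x0 add0r memv_pi.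
  have := daddv_pi_add CU0 (_ : x \in _); rewrite addvC addv_complf memvf.
  move=> /(_ isT); rewrite (daddv_pi_id (capv_compl U) Ux) -/(pi x).
  by move/(canRL (addrK _)); rewrite subrr.
exists (fun i => (linfun (coord X i : E -> K^o) \o pi)%VF), (fun j => X`_j).
  by move=> i j; rewrite comp_lfunE /pi daddv_pi_id // lfunE /= coord_free // eq_sym.
move=> x; rewrite -kerpi; apply/eqP/forallP => [x0 i|x0].
  by rewrite comp_lfunE x0 linear0.
rewrite [LHS](coord_vbasis (memv_pi _ _ _)) big1 // => i _.
by have /eqP := x0 i; rewrite comp_lfunE lfunE /= => ->; rewrite scale0r.
Qed.

(** * The field F as a vector space over its prime subfield *)

Section FieldForm.
Variables (F : finFieldType) (p e : nat).
Hypothesis p_prime : prime p.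
Hypothesis cardF : #|F| = (p ^ e)%N.

Let pcharF : p \in [pchar F]. Proof. exact: card_finPcharP cardF p_prime. Qed.
Local Notation L := (pPrimeCharType pcharF).

Definition prime_subfield (q : nat) : {set F} := [set (n : nat)%:R | n : 'F_q].
Local Notation P := (prime_subfield p).

Lemma dim_over_prime : \dim {: L} = e.
Proof.
by rewrite pprimeChar_dimf [X in logn p X](cardF : #|L| = _) pfactorK.
Qed.

Lemma mem_prime_subfield (x : F) : (x \in P) = ((x : L) \in 1%VS).
Proof.
apply/imsetP/vlineP => [[n _ ->]|[n ->]]; exists n => //.
  by rewrite [RHS]mulr1.
by rewrite [LHS]mulr1.
Qed.

Lemma natr_prime_subfield n : n%:R \in P.
Proof. by rewrite mem_prime_subfield; apply: (@rpredMn L) (mem1v 1%AS). Qed.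

Lemma card_prime_subfield : #|P| = p.
Proof.
have := @card_vspace 'F_p F _ (1%VS : {vspace L}).
rewrite [\dim _](dimv1 (L : falgType 'F_p)) card_Fp // expn1 => {2}<-.
by apply: eq_card => x; apply: mem_prime_subfield.
Qed.

Lemma prime_subfieldP (x : F) : reflect (exists n : nat, x = n%:R) (x \in P).
Proof.
by apply: (iffP idP) => [/imsetP[n _ ->]|[n ->]]; [exists n | apply: natr_prime_subfield].
Qed.

Lemma prime_subfieldN (x : F) : x \in P -> - x \in P.
Proof. by rewrite !mem_prime_subfield => /(@rpredNr L); apply. Qed.

Lemma prime_subfieldV (x : F) : x \in P -> x^-1 \in P.
Proof. by rewrite !mem_prime_subfield => /(@rpredVr L (1%AS : {subfield L})). Qed.

Hypothesis e_prime : prime e.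

(** The degree of an intermediate field divides the prime [e], so it is 1 or [e], and it is 1 only
    for elements of [P]. *)
Lemma adjoin_degree_full (w : F) : w \notin P -> adjoin_degree (1%AS : {subfield L}) (w : L) = e.
Proof.
rewrite mem_prime_subfield => w1.
have dvd : (\dim <<1%AS; w : L>> %| e)%N.
  by rewrite -dim_over_prime; apply: (@field_dimS _ L <<1%AS; w : L>>%AS {:L}%AS (subvf _)).
have := dim_Fadjoin 1%AS (w : L); rewrite (dimv1 (L : falgType 'F_p)) muln1 => dimw.
move: dvd; rewrite dimw => dvd; apply/eqP; move: (primeP e_prime) => [_ /(_ _ dvd)].
case/orP=> [|/eqP <- //].
by rewrite (adjoin_deg_eq1 1%AS (w : L)) (negPf w1).
Qed.

Lemma adjoin_generator (w : F) : w \notin P -> <<1%AS; w : L>>%VS = {: L}%VS.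
Proof.
move=> w1; apply/eqP; rewrite eqEdim subvf /= dim_over_prime dim_Fadjoin adjoin_degree_full //.
by rewrite (dimv1 (L : falgType 'F_p)) muln1.
Qed.

Lemma exists_functional :
  exists2 lam : F -> 'F_p, {morph lam : x y / x + y} & exists x, lam x != 0.
Proof.
case: e dim_over_prime (prime_gt0 e_prime) => // n dimLn _.
have [|mu [c muc _]] := @codim_functionals _ L 0%VS n.+1; first by rewrite dimv0 dimLn.
exists (mu ord0 : L -> _); first by move=> x y; apply: (linearD (mu ord0)).
by exists (c ord0); rewrite muc eqxx oner_eq0.
Qed.

(** * Functionals of F represented by multiplication *)

Section Functional.
Variable lam : F -> 'F_p.
Hypothesis lamD : {morph lam : x y / x + y}.
Hypothesis lam_neq0 : exists x, lam x != 0.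

(** The form [lam (x * y)] is nondegenerate: the multiples of a nonzero [s - t] fill the field, and
    [lam] is not zero there. *)
Lemma functional_mul_inj s t : (forall x, lam (s * x) = lam (t * x)) -> s = t.
Proof.
move=> eq_st; apply/eqP; rewrite -subr_eq0; apply: contraT => st0.
have [x] := lam_neq0; case/negP; apply/eqP; rewrite -(mulVKf st0 x) mulrBl.
by rewrite (morphDB lamD) eq_st subrr.
Qed.

(** By nondegeneracy the linear map sending [s] to [lam (s * _)] is injective from [F] to its dual,
    which has the same dimension, so it is onto. *)
Lemma functional_repr (mu : F -> 'F_p) :
  {morph mu : x y / x + y} -> exists s, forall x, mu x = lam (s * x).
Proof.
move=> muD; have [g lamE] := @morphD_linfun p L ('F_p)^o lam lamD.
have [h muE] := @morphD_linfun p L ('F_p)^o mu muD.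
pose Phi (s : L) : 'Hom(L, ('F_p)^o) := (g \o amull s)%VF.
have PhiD : {morph Phi : s t / s + t}.
  by move=> s t; apply/lfunP=> x; rewrite /Phi add_lfunE !comp_lfunE !lfunE /= mulrDl linearD.
have [G PhiE] := morphD_linfun PhiD.
have kerG : lker G = 0%VS.
  apply/eqP; rewrite -subv0; apply/subvP=> s; rewrite memv_ker PhiE memv0 => /eqP Ps.
  apply/eqP/functional_mul_inj => x; rewrite mul0r (morphD0 lamD).
  by have := congr1 (fun f : 'Hom(L, ('F_p)^o) => f x) Ps; rewrite comp_lfunE !lfunE /= lamE.
have limgG : limg G = fullv.
  apply/eqP; rewrite eqEdim subvf limg_dim_eq ?kerG ?capv0 //.
  by rewrite !dimvf -[X in (_ <= X)%N]muln1 /=; apply: leqnn.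
have /memv_imgP[s _ Gs] : h \in limg G by rewrite limgG memvf.
exists s => x; have := congr1 (fun f : 'Hom(L, ('F_p)^o) => f x) Gs.
by rewrite -muE PhiE comp_lfunE !lfunE /= lamE.
Qed.


Lemma closedD_vspace (S : {set F}) :
  0 \in S -> {in S &, forall x y, x + y \in S} -> exists U : {vspace L}, U =i S.
Proof.
move=> S0 SD; exists <<enum S : seq L>>%VS => x.
rewrite (@span_closedD p L) ?mem_enum // => y z; rewrite !mem_enum; exact: SD.
Qed.

Lemma closedD_functionals (S : {set F}) k :
    0 \in S -> {in S &, forall x y, x + y \in S} -> (#|S| * p ^ k = p ^ e)%N ->
  exists s : 'I_k -> F, exists2 c : 'I_k -> F,
    forall i j, lam (s i * c j) = (i == j)%:R &
    forall x, (x \in S) = [forall i, lam (s i * x) == 0].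
Proof.
move=> S0 SD oS; have [U US] := closedD_vspace S0 SD.
have dimU : (\dim U + k = \dim {:L})%N.
  apply/(expnI (prime_gt1 p_prime)); rewrite dim_over_prime expnD -oS; congr (_ * _)%N.
  have := @card_vspace 'F_p F _ (U : {vspace L}); rewrite card_Fp // => <-.
  by apply: eq_card.
have [mu [c muc Umu]] := codim_functionals dimU.
have muP i : exists s, forall x : F, mu i x = lam (s * x).
  by apply: functional_repr => x y; apply: (linearD (mu i)).
have {}muP i : {s | [forall x : F, mu i x == lam (s * x)]}.
  by apply: sigW; have [s muE] := muP i; exists s; apply/forallP => x; rewrite muE.
have muE i x : mu i x = lam (sval (muP i) * x).
  by case: (muP i) => s /= /forallP/(_ x)/eqP.
exists (fun i => sval (muP i)), c => [i j|x]; first by rewrite -muE.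
by rewrite -US Umu; apply: eq_forallb => i; rewrite -muE.
Qed.

Lemma closedD_hyperplane (S : {set F}) :
    0 \in S -> {in S &, forall x y, x + y \in S} -> #|S| = (p ^ e.-1)%N ->
  exists2 s, s != 0 & forall x, (x \in S) = (lam (s * x) == 0).
Proof.
move=> S0 SD oS; have e1 := prime_gt0 e_prime.
have [|s [c sc Ss]] := @closedD_functionals S 1 S0 SD.
  by rewrite oS -expnD addn1 prednK.
exists (s ord0) => [|x].
  by apply: contra_eq_neq (sc ord0 ord0) => ->; rewrite mul0r (morphD0 lamD).
rewrite Ss; apply/forallP/idP => [/(_ ord0) //|sx i].
by rewrite ord1.
Qed.

(** A subgroup of index [p ^ 2] is cut out by two functionals [lam (s * _)] and [lam (s' * _)]; here
    [w] is the ratio [s' / s]. Thus [S] is a multiple of the standard subgroup attached to [w]. *)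
Lemma closedD_codim2 (S : {set F}) :
    0 \in S -> {in S &, forall x y, x + y \in S} -> #|S| = (p ^ (e - 2))%N ->
  exists s w, [/\ s != 0, w \notin P &
    forall x, (x \in S) = (lam (s * x) == 0) && (lam (s * w * x) == 0)].
Proof.
move=> S0 SD oS; have e1 := prime_gt1 e_prime.
have [|s [c sc Ss]] := @closedD_functionals S 2 S0 SD.
  by rewrite oS -expnD subnK.
have s0 : s ord0 != 0.
  by apply: contra_eq_neq (sc ord0 ord0) => ->; rewrite mul0r (morphD0 lamD).
exists (s ord0), ((s ord0)^-1 * s (lift ord0 ord0)); split => [||x] //.
  (* A ratio in [P] would make the second functional a multiple of the first, which vanishes on the
     dual vector of the second. *)
  apply/negP => /prime_subfieldP [n Dn].
  have Ds : s (lift ord0 ord0) = s ord0 *+ n by rewrite -mulr_natr -Dn mulVKf.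
  have := sc (lift ord0 ord0) (lift ord0 ord0); rewrite Ds mulrnAl (morphDMn lamD) sc.
  by rewrite eqxx mul0rn => /eqP; rewrite eq_sym oner_eq0.
rewrite Ss mulVKf //; apply/forallP/andP => [sx|[sx0 sx1]]; first by split; apply: sx.
by move=> i; case: (unliftP ord0 i) => [j ->|->] //; rewrite (ord1 j).
Qed.


(** The determinant form; by [heltR] it is the commutator map of the Heisenberg group. *)
Definition sympl (u v : F * F) : F := u.1 * v.2 - u.2 * v.1.

Lemma closedD_plane_hyperplane (S : {set F * F}) :
    0 \in S -> {in S &, forall u v, u + v \in S} -> #|S| = (p ^ (2 * e).-1)%N ->
  exists2 w, w != 0 & forall v, (v \in S) = (lam (sympl w v) == 0).
Proof.
move=> S0 SD oS; have e1 := prime_gt0 e_prime.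
pose E : vectType 'F_p := (L * L)%type.
have [U US] : exists U : {vspace E}, U =i S.
  exists <<enum S : seq E>>%VS => x.
  by rewrite (@span_closedD p E) ?mem_enum // => y z; rewrite !mem_enum; apply: SD.
have dimE : \dim {:E} = (2 * e)%N.
  by rewrite dimvf mul2n -addnn -[X in (X + X)%N]dim_over_prime dimvf.
have dimU : (\dim U + 1 = \dim {:E})%N.
  rewrite dimE addn1 -[RHS]prednK ?muln_gt0 //; congr _.+1.
  apply/(expnI (prime_gt1 p_prime)); rewrite -oS.
  have := @card_vspace 'F_p (F * F)%type _ (U : {vspace E}); rewrite card_Fp // => <-.
  by apply: eq_card.
have [mu [c muc Umu]] := codim_functionals dimU.
have muD (u v : E) : mu ord0 (u + v) = mu ord0 u + mu ord0 v by apply: (linearD (mu ord0)).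
have [s sE] : exists s, forall x : F, mu ord0 (x, 0) = lam (s * x).
  by apply: functional_repr => x y; rewrite -muD; congr (mu ord0 (_, _)); rewrite addr0.
have [t tE] : exists t, forall x : F, mu ord0 (0, x) = lam (t * x).
  by apply: functional_repr => x y; rewrite -muD; congr (mu ord0 (_, _)); rewrite addr0.
have stE (v : F * F) : mu ord0 v = lam (sympl (t, - s) v).
  rewrite /sympl /= mulNr opprK addrC lamD -sE -tE -muD.
  by congr (mu ord0 _); case: v => a b; congr (_, _); rewrite /= ?add0r ?addr0.
(* The functional is [lam (s * v.1 + t * v.2)], and the argument of [lam] is the determinant of
   [(t, - s)] and [v]. *)
exists (t, - s) => [|v].
  apply: contra_eq_neq (muc ord0 ord0) => st0; rewrite stE st0 /sympl /=.
  by rewrite !mul0r subrr (morphD0 lamD).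
rewrite -US Umu; apply/forallP/idP => [/(_ ord0)|v0 i]; first by rewrite stE.
by rewrite ord1 stE.
Qed.

(** * The annihilator of a pencil of two functionals *)

Section Annihilator.
Variables (w : F) (wP : w \notin P).

(** If multiplication by [u] kept the kernel of [lam] inside itself, [lam (u * _)] would be a scalar
    multiple of [lam], and nondegeneracy would place [u] in [P]. *)
Lemma functional_kernel_mul (u : F) : u \notin P -> exists2 x, lam x = 0 & lam (u * x) = 1.
Proof.
move=> uP; have lamMn := morphDMn lamD.
suff /existsP[x /andP[/eqP x0 ux0]] : [exists x, (lam x == 0) && (lam (u * x) != 0)].
  exists (x *+ (lam (u * x))^-1%R); first by rewrite lamMn x0 mul0rn.
  by rewrite mulrnAr lamMn Fp_mulrnE mulVf.
apply: contraR uP; rewrite negb_exists => /forallP keru.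
have [y y0] := lam_neq0.
have [c Dc] : exists c : 'F_p, c = lam (u * y) / lam y by eexists.
suff -> : u = c%:R by apply: natr_prime_subfield.
apply: functional_mul_inj => x.
have [k Dk] : exists k : 'F_p, k = lam x / lam y by eexists.
have kx : lam (x - y *+ k) == 0.
  by rewrite (morphDB lamD) lamMn Fp_mulrnE Dk mulfVK // subrr.
have := keru (x - y *+ k); rewrite kx /= negbK mulrBr (morphDB lamD) subr_eq0 => /eqP->.
rewrite mulrnAr mulr_natl !lamMn !Fp_mulrnE Dc Dk.
by rewrite mulrAC [RHS]mulrAC; congr (_ * _); apply: mulrC.
Qed.

Lemma annihilator_dual : exists x1 x2,
  [/\ lam x1 = 1, lam (w * x1) = 0, lam x2 = 0 & lam (w * x2) = 1].
Proof.
have w0 : w != 0 by apply: contraNneq wP => ->; apply: (natr_prime_subfield 0).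
have wVP : w^-1 \notin P by apply: contraNN wP => /prime_subfieldV; rewrite invrK.
have [x2 x20 x21] := functional_kernel_mul wP.
have [y y0 y1] := functional_kernel_mul wVP.
(* The choice of [y] gives [lam y = 0] and [lam (w^-1 * y) = 1], so [w^-1 * y] is dual to the first
   functional. *)
by exists (w^-1 * y), x2; split; rewrite ?mulVKf.
Qed.

Definition annihilator : {set F} := [set x | (lam x == 0) && (lam (w * x) == 0)].

Lemma card_annihilator : #|annihilator| = (p ^ (e - 2))%N.
Proof.
have [x1 [x2 [x11 x10 x20 x21]]] := annihilator_dual.
have lamMn := morphDMn lamD.
(* [F] is the direct sum of the annihilator and the two lines spanned by the dual vectors [x1] and
   [x2]; [f] is the resulting bijection. *)
pose f (n : F * ('F_p * 'F_p)) := n.1 + x1 *+ n.2.1 + x2 *+ n.2.2.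
pose D := setX annihilator [set: 'F_p * 'F_p].
have lf n : n \in D -> lam (f n) = n.2.1 /\ lam (w * f n) = n.2.2.
  case: n => n [a b]; rewrite !inE andbT /= => /andP[/eqP n0 /eqP wn0].
  rewrite /f /= !mulrDr !lamD !mulrnAr !lamMn n0 wn0 x10 x20 x11 x21.
  by rewrite !mul0rn !add0r addr0; split; apply: natr_Zp.
have injf : {in D &, injective f}.
  move=> n m nD mD fnm; have [n1 n2] := lf _ nD; have [m1 m2] := lf _ mD.
  case: n m nD mD fnm n1 n2 m1 m2 => [n [a b]] [m [c d]] _ _ fnm /= n1 n2 m1 m2.
  have ac : a = c by rewrite -n1 -m1 fnm.
  have bd : b = d by rewrite -n2 -m2 fnm.
  by move: fnm; rewrite /f ac bd /= => /addIr /addIr ->.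
have imf : f @: D = [set: F].
  apply/setP => x; rewrite inE; apply/imsetP.
  exists (x - x1 *+ lam x - x2 *+ lam (w * x), (lam x, lam (w * x))); last first.
    by rewrite /f /= addrAC !subrK.
  rewrite !inE andbT !mulrBr !(morphDB lamD) !mulrnAr !lamMn x10 x20 x11 x21.
  by rewrite !mul0rn !subr0 !natr_Zp !subrr eqxx.
have := card_in_imset injf; rewrite imf cardsT cardF cardsX cardsT card_prod card_Fp //.
have e2 := prime_gt1 e_prime.
rewrite -{1}(subnK e2) expnD => /eqP; rewrite -[(p * p)%N]/(p ^ 2)%N eqn_pmul2r.
  by move/eqP.
by rewrite expn_gt0 prime_gt0.
Qed.

(** Double annihilator: modulo the annihilator, [x] is a combination of the dual vectors [x1] and
    [x2], so [mu] is determined by its values there, which are the coefficients of [s]. *)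
Lemma annihilatorE (mu : F -> 'F_p) : {morph mu : x y / x + y} ->
    {in annihilator, forall x, mu x = 0} ->
  exists2 s, s \in [set a + b * w | a in P, b in P] & forall x, mu x = lam (s * x).
Proof.
move=> muD muN; have [x1 [x2 [x11 x10 x20 x21]]] := annihilator_dual.
have lamMn := morphDMn lamD; have muMn := morphDMn muD.
exists ((mu x1)%:R + (mu x2)%:R * w) => [|x].
  by apply: imset2_f; apply: natr_prime_subfield.
pose y := x - x1 *+ lam x - x2 *+ lam (w * x).
have yN : y \in annihilator.
  rewrite inE !mulrBr !(morphDB lamD) !mulrnAr !lamMn x10 x20 x11 x21.
  by rewrite !mul0rn !subr0 !natr_Zp !subrr eqxx.
have := muN y yN; rewrite !(morphDB muD) !muMn => /eqP.
rewrite subr_eq add0r subr_eq => /eqP->.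
rewrite mulrDl lamD -mulrA !mulr_natl !lamMn !Fp_mulrnE addrC.
by congr (_ + _); apply: mulrC.
Qed.

End Annihilator.

(** * Elements of F as polynomials in a generator *)

Section Generator.
Variables (w : F) (wP : w \notin P).
Local Notation pw := (Fadjoin_poly (1%AS : {subfield L}) (w : L)).

Lemma gen_polyK x : (pw x).[w] = x.
Proof. by apply: (@Fadjoin_poly_eq _ L 1%AS w); rewrite adjoin_generator ?memvf. Qed.

Lemma gen_poly_size x : (size (pw x) <= e)%N.
Proof. by rewrite -[X in (_ <= X)%N](adjoin_degree_full wP) size_Fadjoin_poly. Qed.

Lemma gen_poly_over x : (pw x : {poly L}) \is a polyOver (1%VS : {vspace L}).
Proof. exact: Fadjoin_polyOver. Qed.

Lemma gen_poly_unique (q : {poly L}) :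
  q \is a polyOver (1%VS : {vspace L}) -> (size q <= e)%N -> pw q.[w : L] = q.
Proof.
move=> q1 sq; apply: (@Fadjoin_poly_unique _ L 1%AS w) => //.
by rewrite adjoin_degree_full.
Qed.

(** The coefficient of degree [e.-1] is an additive map to the prime field, hence represented by
    some [s]; it is nonzero because it does not vanish at [w ^+ e.-1]. *)
Lemma gen_top_functional :
  exists2 s, s != 0 & forall x, (lam (s * x) == 0) = ((pw x)`_e.-1 == 0).
Proof.
have e1 := prime_gt0 e_prime.
pose t : 1.-tuple L := [tuple 1].
pose mu (x : F) : 'F_p := coord t ord0 (pw x)`_e.-1.
have muD : {morph mu : x y / x + y}.
  by move=> x y; rewrite /mu raddfD coefD linearD.
have muE x : (mu x == 0) = ((pw x)`_e.-1 == 0).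
  have c1 : (pw x)`_e.-1 \in <<t>>%VS.
    by rewrite span_seq1; apply: (polyOverP (gen_poly_over x)).
  have := coord_span c1; rewrite big_ord1 /= -/(mu x) => ->.
  by rewrite scaler_eq0 oner_eq0 orbF.
have [s sE] := functional_repr muD; exists s => [|x]; last by rewrite -sE muE.
apply: contraT; rewrite negbK => /eqP s0.
have := muE (w ^+ e.-1); rewrite sE s0 mul0r (morphD0 lamD) eqxx.
have := @gen_poly_unique 'X^(e.-1); rewrite hornerXn => -> //.
- by rewrite coefXn eqxx oner_eq0.
- by rewrite rpredX // polyOverX.
by rewrite size_polyXn prednK.
Qed.

End Generator.

(* g maps q.[w1] to q.[w2] for q over P of size at most e; lam (s1 * x) = 0 says
   that x = q.[w1] with size q < e, so that q * 'X still has size at most e. *)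
Lemma generator_exchange (w1 w2 : F) : w1 \notin P -> w2 \notin P ->
  exists g : F -> F, [/\ {morph g : x y / x + y}, bijective g, g 1 = 1, g w1 = w2 &
    exists s1 s2, [/\ s1 != 0, s2 != 0 & forall x, lam (s1 * x) = 0 ->
      lam (s2 * g x) = 0 /\ g (w1 * x) = w2 * g x]].
Proof.
move=> w1P w2P.
pose p1 := Fadjoin_poly (1%AS : {subfield L}) (w1 : L).
pose p2 := Fadjoin_poly (1%AS : {subfield L}) (w2 : L).
have gE (q : {poly L}) : q \is a polyOver (1%VS : {vspace L}) -> (size q <= e)%N ->
    (p1 q.[w1 : L]).[w2 : L] = q.[w2 : L].
  by move=> q1 sq; rewrite /p1 gen_poly_unique.
have p21 x : p2 (p1 x).[w2 : L] = p1 x.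
  by rewrite /p2 gen_poly_unique ?gen_poly_over ?gen_poly_size.
have p12 x : p1 (p2 x).[w1 : L] = p2 x.
  by rewrite /p1 gen_poly_unique ?gen_poly_over ?gen_poly_size.
have e1 := prime_gt1 e_prime.
exists (fun x => (p1 x).[w2 : L]); split.
- by move=> x y; rewrite /p1 raddfD hornerD.
- exists (fun x => (p2 x).[w1 : L]) => x; first by rewrite p21 /p1 gen_polyK.
  by rewrite p12 /p2 gen_polyK.
- have := gE 1; rewrite !hornerE; apply; first by rewrite rpred1.
  by rewrite size_poly1 ltnW.
- by have := gE 'X; rewrite !hornerX; apply; rewrite ?polyOverX ?size_polyX.
have [s1 s10 s1E] := gen_top_functional w1P.
have [s2 s20 s2E] := gen_top_functional w2P.
exists s1, s2; split => // x /eqP; rewrite s1E -/p1 => top0.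
split; first by apply/eqP; rewrite s2E -/p2 p21.
have p1K : (p1 x).[w1 : L] = x by apply: gen_polyK.
have := gE (p1 x * 'X); rewrite !hornerMX p1K (mulrC w1) (mulrC w2); apply.
  by rewrite rpredM ?polyOverX ?gen_poly_over.
(* Coefficient [j] of the shifted polynomial is coefficient [j.-1] of [p1 x]; for [j = e] it
   vanishes by [top0], beyond that by the size bound. *)
apply/leq_sizeP => j ej; rewrite coefMX.
case: j ej => [|j ej] //=; rewrite /= -ltnS in ej *.
have [->|ne] := eqVneq j e.-1; first exact/eqP.
apply: (leq_sizeP _ _ (gen_poly_size w1P x)); rewrite leqNgt; apply: contraNN ne.
by move=> je; rewrite eqn_leq -ltnS prednK ?(ltnW e1) // je /= -ltnS prednK ?(ltnW e1).
Qed.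

(** The minimal polynomial over the prime subfield; its degree bound becomes the factor [e] in the
    count of isomorphic quotients. *)
Lemma prime_subfield_annihilator (x : F) :
  exists q : {poly F}, [/\ q != 0, (size q <= e.+1)%N, root q x & forall i, q`_i \in P].
Proof.
pose q : {poly L} := minPoly (1%AS : {subfield L}) (x : L).
have q0 : q != 0 by apply/monic_neq0/monic_minPoly.
have sq : (size q <= e.+1)%N.
  rewrite size_minPoly ltnS; have := dim_Fadjoin 1%AS (x : L).
  rewrite (dimv1 (L : falgType 'F_p)) muln1 => <-; rewrite -[X in (_ <= X)%N]dim_over_prime.
  exact/dimvS/subvf.
have qx : root q x by apply: root_minPoly.
exists q; split => // i; rewrite mem_prime_subfield.
exact/(polyOverP (minPolyOver 1%AS (x : L))).
Qed.

End Functional.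
End FieldForm.

(** * Symmetric coordinates on the Heisenberg group *)

Section HeisCoordinates.
Variable F : finFieldType.
Hypothesis two_neq0 : (2%:R != 0 :> F)%R.
Local Open Scope ring_scope.
Local Notation GL := {'GL_3[F]}.


Lemma heis_mx_unit (a b c : F) : heis_mx a b c \is a GRing.unit.
Proof.
have /mulmx1_unit[] // : heis_mx a b c *m heis_mx (- a) (- b) (a * b - c) = 1%:M.
by rewrite heis_mxM -heis_mx1; congr heis_mx; ring.
Qed.

(* Shifting the central coordinate by v.1 * v.2 / 2 turns the cocycle into the
   alternating form sympl / 2, which linear maps of F^2 can preserve. *)
Definition helt (v : F * F) (c : F) : GL :=
  FinRing.unit 'M[F]_3 (heis_mx_unit v.1 v.2 (c + v.1 * v.2 / 2%:R)).

Definition hvec (g : GL) : F * F := (GLval g 0 1, GLval g 1 2%:R).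
Definition hcen (g : GL) : F := GLval g 0 2%:R - GLval g 0 1 * GLval g 1 2%:R / 2%:R.

Lemma GLval_helt v c : GLval (helt v c) = heis_mx v.1 v.2 (c + v.1 * v.2 / 2%:R).
Proof. by []. Qed.

Lemma heltK v c : (hvec (helt v c) = v) * (hcen (helt v c) = c).
Proof.
rewrite /hvec /hcen !GLval_helt !mxE /= addrK; split => //; exact: esym (surjective_pairing v).
Qed.

Lemma helt_inj u v c d : helt u c = helt v d -> u = v /\ c = d.
Proof. by move=> eq; rewrite -(heltK u c).1 -{2}(heltK u c).2 eq !heltK. Qed.

Lemma helt_heis v c : helt v c \in heis F.
Proof. by apply/heisP; exists v.1, v.2, (c + v.1 * v.2 / 2%:R). Qed.

Lemma heis_heltE g : g \in heis F -> g = helt (hvec g) (hcen g).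
Proof.
case/heisP=> a [b [c Eg]]; apply: val_inj; rewrite /= [LHS]Eg /hvec /hcen Eg !mxE /=.
by rewrite subrK.
Qed.

Lemma heltM u v c d :
  (helt u c * helt v d)%g = helt (u + v) (c + d + sympl u v / 2%:R).
Proof.
apply: val_inj; rewrite /= [LHS]heis_mxM /sympl /=; congr heis_mx.
by field.
Qed.

Lemma helt1 : helt 0 0 = 1%g.
Proof. by apply: val_inj; rewrite /= -[RHS](heis_mx1 F) mul0r mul0r addr0. Qed.

Lemma sympl0 (v : F * F) : (sympl v 0 = 0) * (sympl 0 v = 0).
Proof. by rewrite /sympl /= !(mulr0, mul0r) subrr. Qed.

Lemma symplN (u v : F * F) : (sympl u (- v) = - sympl u v) * (sympl (- u) v = - sympl u v).
Proof. by rewrite /sympl /=; split; ring. Qed.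

Lemma sympl_id (u : F * F) : sympl u u = 0.
Proof. by rewrite /sympl; ring. Qed.

Lemma heltV v c : (helt v c)^-1%g = helt (- v) (- c).
Proof.
apply/eqP; rewrite eq_invg_mul heltM !subrr symplN sympl_id oppr0 mul0r addr0.
by rewrite helt1.
Qed.

(** The cocycle is half of an alternating form, so the two products differ by the whole form, and
    the central coordinates cancel. *)
Lemma heltR u v c d : [~ helt u c, helt v d]%g = helt 0 (sympl u v).
Proof.
rewrite commgEl conjgE !(heltV, heltM); congr helt.
  by rewrite (addrC u) addKr addNr.
by rewrite /sympl /=; field.
Qed.

Lemma hvecM g h : g \in heis F -> h \in heis F -> hvec (g * h)%g = hvec g + hvec h.
Proof. by move=> /heis_heltE-> /heis_heltE->; rewrite heltM !heltK. Qed.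

Definition hcenter : {set GL} := helt 0 @: setT.

Lemma hcenterP g : reflect (exists c, g = helt 0 c) (g \in hcenter).
Proof.
by apply: (iffP imsetP) => [[c _ ->]|[c ->]]; exists c.
Qed.

Lemma mem_hcenter g : (g \in hcenter) = (g \in heis F) && (hvec g == 0).
Proof.
apply/hcenterP/andP => [[c ->]|[/heis_heltE Dg /eqP v0]].
  by rewrite helt_heis heltK.
by exists (hcen g); rewrite -v0 -Dg.
Qed.

Lemma hcenter_group_set : group_set hcenter.
Proof.
apply/group_setP; split; first by apply/hcenterP; exists 0; rewrite helt1.
move=> _ _ /hcenterP[c ->] /hcenterP[d ->]; apply/hcenterP; exists (c + d).
apply: val_inj; rewrite /= [LHS]heis_mxM; congr heis_mx; rewrite /= ?addr0 //.
by rewrite !mul0r !addr0.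
Qed.
Canonical hcenter_group := Group hcenter_group_set.

Lemma sympl_surj (v : F * F) (c : F) : v != 0 -> exists u, sympl v u = c.
Proof.
case: v => a b; have [->|a0] := eqVneq a 0 => v0.
  have b0 : b != 0 by apply: contra_neq v0 => ->.
  by exists (- (c / b), 0); rewrite /sympl /=; field.
by exists (0, c / a); rewrite /sympl /=; field.
Qed.

Lemma heis_der : [~: heis F, heis F] = hcenter.
Proof.
apply/eqP; rewrite eqEsubset gen_subG; apply/andP; split; apply/subsetP => g.
  by case/imset2P=> x y /heis_heltE-> /heis_heltE-> ->; rewrite heltR; apply: imset_f.
case/hcenterP=> c ->; have [|u <-] := @sympl_surj (1, 0) c.
  by rewrite xpair_eqE oner_eq0.
by rewrite -(heltR _ _ 0 0) mem_commg // helt_heis.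
Qed.

Lemma hcenter_sub : hcenter \subset heis F.
Proof. by apply/subsetP => g; rewrite mem_hcenter => /andP[]. Qed.

Lemma hcenter_central : hcenter \subset 'Z(heis F).
Proof.
apply/subsetP => _ /hcenterP[c ->]; apply/centerP; split; first exact: helt_heis.
move=> g /heis_heltE->; rewrite /commute !heltM !sympl0 !mul0r !addr0 add0r.
by rewrite addrC.
Qed.

Lemma card_hcenter : #|hcenter| = #|F|.
Proof. by rewrite card_imset ?cardsT // => c d /helt_inj[]. Qed.

Lemma card_heis : #|heis F| = (#|F| ^ 3)%N.
Proof.
have -> : heis F = (fun x : (F * F) * F => helt x.1 x.2) @: setT.
  apply/setP => g; apply/idP/imsetP => [/heis_heltE->|[x _ ->]].
    by exists (hvec g, hcen g).
  exact: helt_heis.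
rewrite card_imset => [|[u c] [v d] /helt_inj /= [-> -> //]].
by rewrite cardsT !card_prod !expnS expn0 muln1 mulnA.
Qed.

Lemma subcenter_normal (N : {group GL}) : N \subset hcenter -> N <| heis F.
Proof. by move=> sN; apply/sub_center_normal/(subset_trans sN)/hcenter_central. Qed.

End HeisCoordinates.

(** * Equivalences of restricted forms *)

Lemma inj_finType_surj (T : finType) (f : T -> T) : injective f -> forall y, exists x, f x = y.
Proof. by move=> injf y; exists (invF injf y); rewrite f_invF. Qed.

Section SymplEquiv.
Variable F : finFieldType.
Hypothesis two_neq0 : (2%:R != 0 :> F)%R.
Local Open Scope ring_scope.
Local Notation GL := {'GL_3[F]}.

Lemma closedD_half (Z : {set F}) (x : F) :
  0 \in Z -> {in Z &, forall x y, x + y \in Z} -> x \in Z -> x / 2%:R \in Z.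
Proof.
move=> Z0 ZD Zx; have [q q_pr qF] := finPcharP F.
have q_odd : odd q.
  by case/even_prime: q_pr two_neq0 => // q2; move: qF; rewrite q2 inE => /andP[_ ->].
(* In odd characteristic [q], one half is the natural number [(q + 1) / 2], so closure under
   addition suffices. *)
have -> : x / 2%:R = x *+ uphalf q.
  apply: (mulIf two_neq0); rewrite divfK // mulr_natr -mulrnA muln2.
  by rewrite uphalfK q_odd add1n mulrS mulrn_pchar // addr0.
by elim: (uphalf q) => [|n IHn]; rewrite ?mulr0n // mulrS ZD.
Qed.

Lemma closedD_opp (Z : {set F}) (x : F) :
  0 \in Z -> {in Z &, forall x y, x + y \in Z} -> x \in Z -> - x \in Z.
Proof.
move=> Z0 ZD Zx; have [q q_pr qF] := finPcharP F.
have -> : - x = x *+ q.-1.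
  apply/eqP; rewrite eq_sym -addr_eq0 -mulrSr prednK ?prime_gt0 //.
  by rewrite mulrn_pchar.
by elim: (q.-1) => [|n IHn]; rewrite ?mulr0n // mulrS ZD.
Qed.

(* The form has to be preserved only on W1 and only modulo Z2; by
   sympl_equiv_isom this is enough to identify hpre W1 / N1 with hpre W2 / N2,
   where Ni consists of the helt 0 c with c in Zi. *)
Definition sympl_equiv (W1 : {set F * F}) (Z1 : {set F}) (W2 : {set F * F}) (Z2 : {set F}) :=
  exists (phi : F * F -> F * F) (f : F -> F),
    [/\ {morph phi : u v / u + v}, {morph f : x y / x + y}, injective phi, injective f &
    [/\ phi @: W1 = W2, f @: Z1 = Z2 &
      {in W1 &, forall u v, sympl (phi u) (phi v) - f (sympl u v) \in Z2}]].

Lemma sympl_equiv_trans W1 (Z1 : {set F}) W2 (Z2 : {set F}) W3 (Z3 : {set F}) :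
    {in Z3 &, forall x y, x + y \in Z3} ->
  sympl_equiv W1 Z1 W2 Z2 -> sympl_equiv W2 Z2 W3 Z3 -> sympl_equiv W1 Z1 W3 Z3.
Proof.
move=> Z3D [phi [f [phiD fD phiI fI [<- <- eqZ2]]]] [psi [g [psiD gD psiI gI [<- Z3E eqZ3]]]].
exists (psi \o phi), (g \o f); split.
- by move=> u v /=; rewrite phiD psiD.
- by move=> u v /=; rewrite fD gD.
- exact: inj_comp.
- exact: inj_comp.
split; [exact: imset_comp | by rewrite imset_comp |].
move=> u v W1u W1v /=; set s := sympl _ _; set t := sympl u v.
(* The error of the composite is the error of the second equivalence plus the image of the error of
   the first. *)
have -> : s - g (f t) = (s - g (sympl (phi u) (phi v))) + g (sympl (phi u) (phi v) - f t).
  by rewrite (morphDB gD (sympl _ _) (f t)) addrA subrK.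
by rewrite Z3D ?eqZ3 ?imset_f // -Z3E imset_f // eqZ2.
Qed.

Lemma sympl_equiv_sym W1 (Z1 : {set F}) W2 (Z2 : {set F}) :
    0 \in Z1 -> {in Z1 &, forall x y, x + y \in Z1} ->
  sympl_equiv W1 Z1 W2 Z2 -> sympl_equiv W2 Z2 W1 Z1.
Proof.
move=> Z10 Z1D [phi [f [phiD fD phiI fI [W2E Z2E eqZ2]]]].
exists (invF phiI), (invF fI); split.
- by move=> u v; apply: (phiI); rewrite phiD !f_invF.
- by move=> u v; apply: (fI); rewrite fD !f_invF.
- exact: can_inj (f_invF phiI).
- exact: can_inj (f_invF fI).
split.
- by rewrite -W2E -imset_comp (eq_imset _ (invF_f phiI)) imset_id.
- by rewrite -Z2E -imset_comp (eq_imset _ (invF_f fI)) imset_id.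
rewrite -W2E => _ _ /imsetP[u W1u ->] /imsetP[v W1v ->]; rewrite !invF_f.
rewrite -[_ - _]opprB; apply: closedD_opp => //.
have := eqZ2 u v W1u W1v; rewrite -Z2E => /imsetP[z Z1z Dz].
suff -> : invF fI (sympl (phi u) (phi v)) - sympl u v = z by [].
by apply: (fI); rewrite (morphDB fD) f_invF.
Qed.

Definition hpre (W : {set F * F}) : {set GL} := [set g in heis F | hvec g \in W].

Lemma helt_hpre W v c : (helt v c \in hpre W) = (v \in W).
Proof. by rewrite inE helt_heis heltK. Qed.

Lemma helt_hcen (Z : {set F}) v c : (helt v c \in helt 0 @: Z) = (v == 0) && (c \in Z).
Proof.
apply/imsetP/andP => [[d Zd /helt_inj[-> ->]]|[/eqP-> Zc]]; first by rewrite eqxx.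
by exists c.
Qed.

(** The map sending [helt v c] to [helt (phi v) (f c)] is multiplicative modulo [N2] and has kernel
    [N1] there; the first isomorphism theorem does the rest. The image of [hcenter F] is recorded
    because the pair count needs it. *)
Lemma sympl_equiv_isom W1 (Z1 : {set F}) W2 (Z2 : {set F}) (N1 N2 M1 M2 : {group GL}) :
    N1 = helt 0 @: Z1 :> {set GL} -> N2 = helt 0 @: Z2 :> {set GL} ->
    M1 = hpre W1 :> {set GL} -> M2 = hpre W2 :> {set GL} ->
    sympl_equiv W1 Z1 W2 Z2 ->
  exists h : {morphism (M1 / N1)%g >-> coset_of N2},
    [/\ 'injm h, h @* (M1 / N1) = M2 / N2 & h @* (hcenter F / N1) = hcenter F / N2]%g.
Proof.
move=> N1E N2E M1E M2E [phi [f [phiD fD phiI fI [W2E Z2E eqZ2]]]].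
have phi0 := morphD0 phiD; have f0 := morphD0 fD.
have Z2_0 : 0 \in Z2.
  by have := group1 N2; rewrite -(helt1 F) N2E helt_hcen eqxx.
have Z2D : {in Z2 &, forall x y, x + y \in Z2}.
  move=> x y Zx Zy; have := @groupM _ N2 (helt 0 x) (helt 0 y).
  by rewrite N2E !(helt_hcen, heltM) // !eqxx !sympl0 mul0r !addr0 eqxx; apply.
have nN2 : heis F \subset 'N(N2).
  apply/normal_norm/subcenter_normal => //.
  by rewrite N2E; apply/subsetP => _ /imsetP[c _ ->]; apply/hcenterP; exists c.
have W1_0 : 0 \in W1 by have := group1 M1; rewrite -(helt1 F) M1E helt_hpre.
have sM1 : M1 \subset heis F by rewrite M1E; apply/subsetP => g; rewrite inE => /andP[].
pose Th (g : GL) := helt (phi (hvec g)) (f (hcen g)).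
have ThM : {in M1 &, {morph (fun g => coset N2 (Th g)) : g h / (g * h)%g}}.
  move=> g h M1g M1h; rewrite -morphM ?(subsetP nN2) ?helt_heis //.
  have W1g : hvec g \in W1 by move: M1g; rewrite M1E inE => /andP[].
  have W1h : hvec h \in W1 by move: M1h; rewrite M1E inE => /andP[].
  have := heis_heltE (subsetP sM1 g M1g); have := heis_heltE (subsetP sM1 h M1h).
  set u := hvec g in W1g *; set v := hvec h in W1h *; set c := hcen g; set d := hcen h => -> ->.
  rewrite /Th !(heltM, heltK) // phiD !fD.
  (* Half the defect of the form is the central factor by which [Th] fails to be multiplicative; it
     lies in [N2]. *)
  pose z := (f (sympl u v) - sympl (phi u) (phi v)) / 2%:R.
  have zN : helt 0 z \in N2.
    rewrite N2E helt_hcen eqxx /= closedD_half // -opprB closedD_opp //.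
    exact: eqZ2.
  have fhalf : f (sympl u v / 2%:R) = f (sympl u v) / 2%:R.
    apply: (mulIf two_neq0); rewrite divfK // mulr_natr -(morphDMn fD).
    by rewrite -[_ / _ *+ _]mulr_natr divfK.
  rewrite -[RHS](coset_kerr _ zN) heltM // sympl0 mul0r !addr0 fhalf.
  by congr (coset N2 (helt _ _)); rewrite /z; field.
pose th := Morphism ThM.
have ThE (A : {set GL}) : A \subset M1 -> th @* A = ((Th @: A) / N2)%g.
  move=> sA; rewrite morphimEsub // /quotient morphimEsub; first by rewrite -imset_comp.
  by apply/subsetP => _ /imsetP[g _ ->]; rewrite (subsetP nN2) ?helt_heis.
have fsurj := inj_finType_surj fI.
have ThM1 : Th @: M1 = M2.
  apply/setP => g; apply/imsetP/idP => [[h M1h ->]|].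
    rewrite M2E helt_hpre -W2E imset_f //.
    by move: M1h; rewrite M1E inE => /andP[].
  rewrite M2E inE -W2E => /andP[Hg /imsetP[u W1u vE]]; rewrite (heis_heltE Hg) vE.
  have [c <-] := fsurj (hcen g).
  by exists (helt u c); rewrite ?M1E ?helt_hpre // /Th !heltK.
have sHM : hcenter F \subset M1.
  by apply/subsetP => _ /hcenterP[c ->]; rewrite M1E helt_hpre.
have Thc : Th @: hcenter F = hcenter F.
  apply/setP => g; apply/imsetP/idP => [[_ /hcenterP[c ->] ->]|/hcenterP[c ->]].
    by rewrite /Th !heltK // phi0; apply/hcenterP; eexists.
  have [d <-] := fsurj c; exists (helt 0 d); first by apply/hcenterP; exists d.
  by rewrite /Th !heltK // phi0.
have kerth : ('ker th)%G = N1.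
  apply: group_inj; apply/setP => g; apply/idP/idP => [kg|].
    have M1g := dom_ker kg; have /= := mker kg; move/coset_idr.
    rewrite (subsetP nN2) ?helt_heis // => /(_ isT).
    rewrite N2E helt_hcen -phi0 (inj_eq phiI) => /andP[/eqP v0].
    rewrite -Z2E (mem_imset _ _ fI) => Zc.
    by rewrite (heis_heltE (subsetP sM1 g M1g)) v0 N1E helt_hcen eqxx.
  rewrite N1E => /imsetP[c Z1c ->]; rewrite mem_morphpre ?M1E ?helt_hpre //.
  rewrite inE /=; apply/eqP; apply: coset_id; rewrite /Th !heltK // phi0.
  by rewrite N2E helt_hcen eqxx -Z2E imset_f.
have [h injh him] := first_isom th.
(* The type of cosets depends on the subgroup, so [N1] is replaced by the kernel itself before [h]
   can be used. *)
case: _ / kerth in h injh him *.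
exists h; split => //; first by rewrite him // ThE // ThM1.
by rewrite him // ThE // Thc.
Qed.

End SymplEquiv.

Lemma imset_preim_inj (T : finType) (f : T -> T) (A B : {set T}) :
  injective f -> (forall x, (x \in A) = (f x \in B)) -> f @: A = B.
Proof.
move=> fI AB; apply/setP => y; have [x <-] := inj_finType_surj fI y.
by rewrite (mem_imset _ _ fI) AB.
Qed.

(* sympl w u * sympl t v - sympl t u * sympl w v = sympl w t * sympl u v. *)
Lemma sympl_equiv_pairing (F : finFieldType) (w t : F * F) (W : {set F * F}) (Z : {set F}) :
    sympl w t != 0 -> 0 \in Z ->
  sympl_equiv [set v | (sympl w v, sympl t v) \in W] [set x | sympl w t * x \in Z] W Z.
Proof.
set s := sympl w t => s0 Z0.
pose phi v := (sympl w v, sympl t v).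
have phiI : injective phi.
  (* Cramer's rule recovers a vector from its pairings with [w] and [t]. *)
  apply: (@can_inj _ _ _ (fun v => ((v.1 * t.1 - v.2 * w.1) / s, (v.1 * t.2 - v.2 * w.2) / s))).
  move=> [a b]; rewrite /phi /s /sympl /=.
  by congr (_, _); field.
have sI : injective ( *%R s) by apply: mulfI.
exists phi, ( *%R s); split => //.
- by move=> u v; rewrite /phi /sympl /=; apply: injective_projections => /=; ring.
- exact: mulrDr.
split.
- by apply: imset_preim_inj => // v; rewrite inE.
- by apply: imset_preim_inj => // x; rewrite inE.
move=> u v _ _; suff -> : sympl (phi u) (phi v) - s * sympl u v = 0 by [].
by rewrite /phi /s /sympl /=; ring.
Qed.

(** * Normal forms for hyperplanes of F^2 and subgroups of F *)

Section Equivalences.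
Variables (F : finFieldType) (p e : nat).
Hypothesis p_prime : prime p.
Hypothesis cardF : #|F| = (p ^ e)%N.
Hypothesis e_prime : prime e.
Variable lam : F -> 'F_p.
Hypothesis lamD : {morph lam : x y / x + y}.
Hypothesis lam_neq0 : exists x, lam x != 0.
Local Notation P := (prime_subfield F p).
Local Notation annihilator := (annihilator lam).

(** [k] is the adjoint of [h] for the nondegenerate form [lam (x * y)]. *)
Lemma adjoint_exists (h : F -> F) : {morph h : x y / x + y} -> bijective h ->
  exists k : F -> F, [/\ {morph k : x y / x + y}, injective k &
    forall x y, lam (x * k y) = lam (h x * y)].
Proof.
move=> hD [h' hK h'K]; have kP y : {s | [forall x, lam (s * x) == lam (h x * y)]}.
  apply: sigW; have [|s sE] := functional_repr p_prime cardF lamD lam_neq0 (mu := fun x => lam (h x * y)).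
    by move=> x x'; rewrite hD mulrDl lamD.
  by exists s; apply/forallP => x; rewrite sE.
pose k y := sval (kP y); have kE x y : lam (x * k y) = lam (h x * y).
  by rewrite mulrC; apply/eqP; have /forallP := svalP (kP y).
exists k; split => // [y z|y z kyz].
  by apply: (functional_mul_inj lamD lam_neq0) => x; rewrite mulrC kE mulrDr mulrDl !lamD -!kE !(mulrC x).
apply: (functional_mul_inj lamD lam_neq0) => x; rewrite -(h'K x) -!(mulrC (h (h' x))) -!kE.
by rewrite kyz.
Qed.

Definition std_hyperplane : {set F * F} := [set v | lam v.1 == 0].

(** On the hyperplane the first coordinate lies in the kernel of [lam], where the exchange map
    intertwines [w1] and [w2]. Moving the second coordinate by the adjoint of the inverse then
    preserves both [lam] and its twist by [w1] or [w2] on the determinant. *)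
Lemma sympl_equiv_std w1 w2 : w1 \notin P -> w2 \notin P ->
  sympl_equiv std_hyperplane (annihilator w1) std_hyperplane (annihilator w2).
Proof.
move=> w1P w2P.
have [g [gD [g' gK g'K] g1 gw [s1 [s2 [s10 s20 gs]]]]] :=
  generator_exchange p_prime cardF e_prime lamD lam_neq0 w1P w2P.
have g'D : {morph g' : x y / x + y}.
  by move=> x y; apply: (can_inj gK); rewrite gD !g'K.
(* Rescaling by [s1] and [s2] turns both hyperplanes of [generator_exchange] into the kernel of
   [lam]. *)
pose phi x := s2 * g (s1^-1 * x); pose phi' x := s1 * g' (s2^-1 * x).
have phiK : cancel phi phi' by move=> x; rewrite /phi /phi' mulKf // gK mulVKf.
have phi'K : cancel phi' phi by move=> x; rewrite /phi /phi' mulKf // g'K mulVKf.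
have phiD : {morph phi : x y / x + y} by move=> x y; rewrite /phi mulrDr gD mulrDr.
have phi'D : {morph phi' : x y / x + y} by move=> x y; rewrite /phi' mulrDr g'D mulrDr.
have phi_ker x : lam x = 0 -> lam (phi x) = 0 /\ phi (w1 * x) = w2 * phi x.
  move=> x0; have [|l m] := gs (s1^-1 * x); first by rewrite mulVKf.
  by rewrite /phi l mulrCA m mulrCA.
have [psi [psiD psiI psiE]] := adjoint_exists phi'D (Bijective phi'K phiK).
have [f [fD fI fE]] := adjoint_exists g'D (Bijective g'K gK).
(* [f] is the adjoint of [g'], which fixes 1 and sends [w2] to [w1]; so [f] matches the two
   functionals defining the annihilators. *)
have lamf x : lam (f x) = lam x by rewrite -[f x]mul1r fE -g1 gK mul1r.
have lamwf x : lam (w2 * f x) = lam (w1 * x) by rewrite fE -gw gK.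
exists (fun v => (phi v.1, psi v.2)), f; split => //.
- by move=> u v /=; rewrite phiD psiD.
- by move=> [a b] [c d] [/(can_inj phiK) -> /psiI ->].
split.
- apply/eqP; rewrite eqEcard card_imset ?leqnn ?andbT; last first.
    by move=> [a b] [c d] [/(can_inj phiK) -> /psiI ->].
  apply/subsetP => _ /imsetP[v v0 ->]; rewrite inE /=.
  by move: v0; rewrite inE => /eqP/phi_ker[-> _].
- by apply: imset_preim_inj => // x; rewrite !inE lamf lamwf.
move=> [a b] [c d]; rewrite !inE /= => /eqP/phi_ker[_ a0] /eqP/phi_ker[_ c0].
have lam1 : lam (phi a * psi d - psi b * phi c) = lam (a * d - b * c).
  by rewrite !(morphDB lamD) psiE phiK (mulrC (psi b)) psiE phiK (mulrC c).
have lamw : lam (w2 * (phi a * psi d - psi b * phi c)) = lam (w1 * (a * d - b * c)).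
  have -> : w2 * (phi a * psi d - psi b * phi c) = phi (w1 * a) * psi d - phi (w1 * c) * psi b.
    by rewrite a0 c0; move: (phi a) (phi c) (psi b) (psi d) => x y z t; ring.
  rewrite (morphDB lamD (_ * _)) !psiE !phiK -(morphDB lamD); congr lam; ring.
rewrite /sympl /= mulrBr !(morphDB lamD _ (f _)) (morphDB lamD _ (w2 * f _)) lamf lamwf.
by rewrite lam1 lamw !subrr eqxx.
Qed.

Lemma annihilator_closedD w :
  0 \in annihilator w /\ {in annihilator w &, forall x y, x + y \in annihilator w}.
Proof.
split=> [|x y]; first by rewrite inE mulr0 (morphD0 lamD) eqxx.
by rewrite !inE mulrDr !lamD => /andP[/eqP-> /eqP->] /andP[/eqP-> /eqP->]; rewrite addr0 eqxx.
Qed.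

Lemma sympl_equiv_std_exists (W : {set F * F}) (Z : {set F}) :
    0 \in W -> {in W &, forall u v, u + v \in W} -> #|W| = (p ^ (2 * e).-1)%N ->
    0 \in Z -> {in Z &, forall x y, x + y \in Z} -> #|Z| = (p ^ (e - 2))%N ->
  exists2 w, w \notin P & sympl_equiv W Z std_hyperplane (annihilator w).
Proof.
move=> W0 WD oW Z0 ZD oZ.
have [w w0 WE] := closedD_plane_hyperplane p_prime cardF e_prime lamD lam_neq0 W0 WD oW.
have [s [om [s0 omP ZE]]] := closedD_codim2 p_prime cardF e_prime lamD lam_neq0 Z0 ZD oZ.
(* With [sympl w t = s], the linear map given by the pairings with [w] and [t] normalises both sets
   at once: [w] takes care of [W], and the determinant [s] of [Z]. *)
exists om => //; have [t wt] := sympl_surj s w0.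
have -> : W = [set v | (sympl w v, sympl t v) \in std_hyperplane].
  by apply/setP => v; rewrite !inE WE.
have -> : Z = [set x | sympl w t * x \in annihilator om].
  by apply/setP => x; rewrite !inE ZE wt mulrA (mulrC om).
by apply: sympl_equiv_pairing; [rewrite wt | have [] := annihilator_closedD om].
Qed.

Lemma sympl_equiv_hyperplane (W1 W2 : {set F * F}) (Z1 Z2 : {set F}) :
    0 \in W1 -> {in W1 &, forall u v, u + v \in W1} -> #|W1| = (p ^ (2 * e).-1)%N ->
    0 \in Z1 -> {in Z1 &, forall x y, x + y \in Z1} -> #|Z1| = (p ^ (e - 2))%N ->
    0 \in W2 -> {in W2 &, forall u v, u + v \in W2} -> #|W2| = (p ^ (2 * e).-1)%N ->
    0 \in Z2 -> {in Z2 &, forall x y, x + y \in Z2} -> #|Z2| = (p ^ (e - 2))%N ->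
  sympl_equiv W1 Z1 W2 Z2.
Proof.
move=> W10 W1D oW1 Z10 Z1D oZ1 W20 W2D oW2 Z20 Z2D oZ2.
have [w1 w1P eq1] := sympl_equiv_std_exists W10 W1D oW1 Z10 Z1D oZ1.
have [w2 w2P eq2] := sympl_equiv_std_exists W20 W2D oW2 Z20 Z2D oZ2.
apply: (sympl_equiv_trans Z2D eq1); apply: (sympl_equiv_trans Z2D (sympl_equiv_std w1P w2P)).
exact: sympl_equiv_sym eq2.
Qed.

(** A hyperplane of [F] is a multiple of the kernel of [lam], and a linear map of [F^2] of the right
    determinant absorbs the multiplier. *)
Lemma sympl_equiv_corank1 (Z1 Z2 : {set F}) :
    0 \in Z1 -> {in Z1 &, forall x y, x + y \in Z1} -> #|Z1| = (p ^ e.-1)%N ->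
    0 \in Z2 -> {in Z2 &, forall x y, x + y \in Z2} -> #|Z2| = (p ^ e.-1)%N ->
  sympl_equiv setT Z1 setT Z2.
Proof.
move=> Z10 Z1D oZ1 Z20 Z2D oZ2; pose K := [set x | lam x == 0].
have K0 : 0 \in K by rewrite inE (morphD0 lamD).
have stdK (Z : {set F}) : 0 \in Z -> {in Z &, forall x y, x + y \in Z} -> #|Z| = (p ^ e.-1)%N ->
    sympl_equiv setT Z setT K.
  move=> Z0 ZD oZ; have [s s0 ZE] := closedD_hyperplane p_prime cardF e_prime lamD lam_neq0 Z0 ZD oZ.
  have st : sympl (1, 0) (0, s) = s by rewrite /sympl /= mul1r mul0r subr0.
  have := @sympl_equiv_pairing F (1, 0) (0, s) setT K; rewrite st => /(_ s0 K0).
  congr (sympl_equiv _ _ _ _); first by apply/setP => v; rewrite !inE.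
  by apply/setP => x; rewrite !inE ZE.
apply: (sympl_equiv_trans Z2D (stdK _ Z10 Z1D oZ1)).
by apply: sympl_equiv_sym => //; apply: stdK.
Qed.

End Equivalences.

(** * Isomorphisms between quotients *)

Lemma odd_pchar_two_neq0 (F : finFieldType) p e : prime p -> (2 < p)%N -> #|F| = (p ^ e)%N ->
  (2%:R != 0 :> F).
Proof.
move=> p_prime p_gt2 cardF; rewrite -(dvdn_pcharf (card_finPcharP cardF p_prime)).
by apply: contraL p_gt2 => /dvdn_leq; rewrite -leqNgt; apply.
Qed.

Lemma coset_commg (gT : finGroupType) (H : {group gT}) x y :
  x \in 'N(H) -> y \in 'N(H) -> coset H [~ x, y]%g = [~ coset H x, coset H y]%g.
Proof. exact: morphR. Qed.

Section Isomorphisms.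
Variables (F : finFieldType) (p e : nat).
Hypothesis p_prime : prime p.
Hypothesis two_neq0 : (2%:R != 0 :> F)%R.
Hypothesis cardF : #|F| = (p ^ e)%N.
Hypothesis e_prime : prime e.
Variable lam : F -> 'F_p.
Hypothesis lamD : {morph lam : x y / x + y}.
Hypothesis lam_neq0 : exists x, lam x != 0.
Local Notation P := (prime_subfield F p).
Local Notation annihilator := (annihilator lam).
Local Notation GL := {'GL_3[F]}.

(** The standard kernel attached to [w]. The generated subgroup only packages the set as a group: by
    [hkerE] the set is already closed. *)
Definition hker (w : F) : {group GL} := <<[set helt 0 c | c in annihilator w]>>%G.

Lemma hkerE w : hker w = [set helt 0 c | c in annihilator w] :> {set GL}.
Proof.
apply: gen_set_id; have [A0 AD] := annihilator_closedD lamD w.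
apply/group_setP; split; first by rewrite -(helt1 F) helt_hcen eqxx.
move=> _ _ /imsetP[c Ac ->] /imsetP[d Ad ->].
by rewrite heltM // helt_hcen !sympl0 mul0r !addr0 eqxx AD.
Qed.

Lemma hker_sub w : hker w \subset hcenter F.
Proof. by rewrite hkerE; apply: imsetS; apply: subsetT. Qed.

Definition span2 w : {set F} := [set a + b * w | a in P, b in P].

(* The map phi induced on F^2 satisfies phi (r * u) = w2 * phi u, since both sides
   pair in the same way with the image of phi. *)
Lemma isog_hker_root w1 w2 : w1 \notin P -> w2 \notin P ->
    heis F / hker w1 \isog heis F / hker w2 ->
  exists2 r, r \notin P & exists2 s, (s != 0) && (s \in span2 w1) & s * r \in span2 w1 /\
    forall q : {poly F}, (forall i, q`_i \in P) -> root q r -> root q w2.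
Proof.
move=> w1P w2P.
move: (hker w1) (hker w2) (hkerE w1) (hkerE w2) (hker_sub w1) (hker_sub w2).
move=> N1 N2 N1E N2E sN1 sN2.
have nN1 : heis F \subset 'N(N1) by apply/normal_norm/subcenter_normal.
have nN2 : heis F \subset 'N(N2) by apply/normal_norm/subcenter_normal.
(* [Fh] lifts the isomorphism to a map on [H] through coset representatives; it is multiplicative
   only modulo [N2]. *)
case/isogP=> f injf imf; pose Fh g := repr (f (coset N1 g)).
have HFh g : g \in heis F -> Fh g \in heis F.
  move=> Hg; have : f (coset N1 g) \in (heis F / N2)%g by rewrite -imf mem_morphim ?mem_quotient.
  case/morphimP => y nNy Hy fy; have := mem_repr_coset (f (coset N1 g)).
  rewrite -/(Fh g) fy val_coset // => /rcosetP[n Nn ->].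
  by rewrite groupM // (subsetP (hcenter_sub F)) // (subsetP sN2).
have FhE g : coset N2 (Fh g) = f (coset N1 g) by apply: coset_reprK.
have eqN2 x y : x \in heis F -> y \in heis F -> coset N2 x = coset N2 y ->
    exists2 n, n \in annihilator w2 & x = (helt 0 n * y)%g.
  move=> Hx Hy eqxy; have /rcosetP[z] : x \in (N2 :* y)%g.
    by apply/rcoset_kercosetP; rewrite ?(subsetP nN2).
  by rewrite N2E => /imsetP[n An ->] ->; exists n.
have FhM g h : g \in heis F -> h \in heis F -> coset N2 (Fh (g * h)%g) = coset N2 (Fh g * Fh h)%g.
  move=> Hg Hh; rewrite FhE (coset_morphM (subsetP nN2 _ (HFh _ Hg)) (subsetP nN2 _ (HFh _ Hh))) !FhE.
  by rewrite (coset_morphM (subsetP nN1 _ Hg) (subsetP nN1 _ Hh)) morphM ?mem_quotient.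
have eqhv x y : x \in heis F -> y \in heis F -> coset N2 x = coset N2 y -> hvec x = hvec y.
  move=> Hx Hy /(eqN2 _ _ Hx Hy)[n An ->].
  by rewrite hvecM ?helt_heis // heltK add0r.
have eqhc c d : coset N2 (helt 0 c) = coset N2 (helt 0 d) ->
    lam c = lam d /\ lam (w2 * c) = lam (w2 * d).
  case/eqN2; rewrite ?helt_heis // => n; rewrite inE => /andP[/eqP n0 /eqP wn0].
  rewrite heltM // => /helt_inj[_ ->]; rewrite !sympl0 mul0r addr0.
  by rewrite mulrDr !lamD n0 wn0 !add0r.
pose phi v := hvec (Fh (helt v 0)).
have Fhc u v : coset N2 (Fh (helt 0 (sympl u v))) = coset N2 (helt 0 (sympl (phi u) (phi v))).
  rewrite -(heltR _ u v 0 0) // FhE; set g := helt u 0; set h := helt v 0.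
  have [Hg Hh] : g \in heis F /\ h \in heis F by rewrite !helt_heis.
  have [N1g N1h] := (subsetP nN1 _ Hg, subsetP nN1 _ Hh).
  have [N2g N2h] := (subsetP nN2 _ (HFh _ Hg), subsetP nN2 _ (HFh _ Hh)).
  rewrite (coset_commg N1g N1h).
  rewrite (morphR f (mem_quotient N1 Hg) (mem_quotient N1 Hh)).
  rewrite /= -!FhE.
  rewrite -(coset_commg N2g N2h); congr (coset N2 _).
  by rewrite (heis_heltE (HFh _ Hg)) (heis_heltE (HFh _ Hh)) heltR.
have e1 : (1, 0) != 0 :> F * F by rewrite xpair_eqE oner_eq0.
(* Every central element is a commutator with [helt (1, 0) 0], so [Fhc] shows that its lift is
   central. *)
have Fcen c : exists d, Fh (helt 0 c) = helt 0 d.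
  have [u <-] := sympl_surj c e1.
  have [n _ ->] := eqN2 _ _ (HFh _ (helt_heis 0 _)) (helt_heis 0 _) (Fhc (1, 0) u).
  by rewrite heltM // addr0; eexists.
pose k c := hcen (Fh (helt 0 c)).
have kE c : Fh (helt 0 c) = helt 0 (k c) by rewrite /k; have [d ->] := Fcen c; rewrite heltK.
have kD c d : coset N2 (helt 0 (k (c + d))) = coset N2 (helt 0 (k c + k d)).
  have := FhM (helt 0 c) (helt 0 d); rewrite !helt_heis => /(_ isT isT).
  by rewrite !kE !heltM // sympl0 mul0r !addr0 kE.
have kN c : c \in annihilator w1 -> coset N2 (helt 0 (k c)) = coset N2 (helt 0 0).
  move=> Ac; rewrite -kE FhE (helt1 F) coset_id; last by rewrite N1E imset_f.
  by rewrite (morph1 f) coset_id.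
(* The two functionals defining [N2], pulled back to the centre, vanish on [annihilator w1]; they
   are therefore represented by elements [s] and [t] of the pencil of [w1]. *)
pose m1 c := lam (k c); pose m2 c := lam (w2 * k c).
have [s As sE] : exists2 s, s \in span2 w1 & forall x, m1 x = lam (s * x).
  apply: (annihilatorE p_prime cardF) => // [c d|c /kN/eqhc[]].
    by have /eqhc[] := kD c d; rewrite lamD.
  by rewrite (morphD0 lamD).
have [t At tE] : exists2 t, t \in span2 w1 & forall x, m2 x = lam (t * x).
  apply: (annihilatorE p_prime cardF) => // [c d|c /kN/eqhc[_]].
    by have /eqhc[_] := kD c d; rewrite (mulrDr w2 (k c) (k d)) lamD.
  by rewrite mulr0 (morphD0 lamD).
have sphi u v : lam (sympl (phi u) (phi v)) = lam (s * sympl u v).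
  by rewrite -sE; have := Fhc u v; rewrite kE => /eqhc[].
have tphi u v : lam (w2 * sympl (phi u) (phi v)) = lam (t * sympl u v).
  by rewrite -tE; have := Fhc u v; rewrite kE => /eqhc[_].
have hvFhM g h : g \in heis F -> h \in heis F -> hvec (Fh (g * h)%g) = hvec (Fh g) + hvec (Fh h).
  move=> Hg Hh; rewrite -hvecM ?HFh //; apply: eqhv (FhM _ _ Hg Hh).
    by apply: HFh; rewrite groupM.
  by rewrite groupM ?HFh.
have hvFh g : g \in heis F -> hvec (Fh g) = phi (hvec g).
  move=> Hg; have {1}-> : g = (helt (hvec g) 0 * helt 0 (hcen g))%g.
    by rewrite heltM // !sympl0 mul0r !addr0 add0r -heis_heltE.
  by rewrite hvFhM ?helt_heis // (kE (hcen g)) heltK addr0.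
have phiD u v : phi (u + v) = phi u + phi v.
  have := hvFhM _ _ (helt_heis u 0) (helt_heis v 0).
  by rewrite heltM // !hvFh ?helt_heis // !heltK.
have phi_surj v : exists u, phi u = v.
  have : coset N2 (helt v 0) \in (heis F / N2)%g by rewrite mem_quotient ?helt_heis.
  rewrite -imf => /morphimP[_ _ /morphimP[g _ Hg ->]]; rewrite -FhE => eqg.
  exists (hvec g); rewrite -hvFh //.
  by rewrite -(eqhv _ _ (helt_heis v 0) (HFh _ Hg) eqg) heltK.
have [y y0] := lam_neq0.
have s0 : s != 0.
  apply: contra_neq y0 => s0; have [u uE] := phi_surj (1, 0); have [v vE] := phi_surj (0, y).
  have := sphi u v; rewrite s0 mul0r (morphD0 lamD) uE vE /sympl /=.
  by rewrite mul1r mul0r subr0.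
pose sc (a : F) (u : F * F) := (a * u.1, a * u.2).
pose r := s^-1 * t.
have nondeg u v : (forall z, lam (sympl u z) = lam (sympl v z)) -> u = v.
  move=> eq_uv; apply: injective_projections.
    apply: (functional_mul_inj lamD lam_neq0) => x; have := eq_uv (0, x).
    by rewrite /sympl /= !mulr0 !subr0.
  apply/oppr_inj/(functional_mul_inj lamD lam_neq0) => x; have := eq_uv (x, 0).
  by rewrite /sympl /= !mulr0 !add0r !mulNr.
have phir u : phi (sc r u) = sc w2 (phi u).
  apply: nondeg => z; have [v <-] := phi_surj z; rewrite sphi.
  have -> : s * sympl (sc r u) v = t * sympl u v.
    by rewrite /sympl /sc /r /=; field.
  rewrite -tphi; congr lam; rewrite /sympl /sc /=.
  by rewrite mulrBr !mulrA.
have phi0 : phi 0 = 0 by apply: (morphD0 phiD).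
have phin n u : phi (sc n%:R u) = sc n%:R (phi u).
  elim: n => [|n IHn]; first by rewrite /sc !mul0r -[RHS]/(0 : F * F) -phi0.
  have scS z : sc n.+1%:R z = sc n%:R z + z.
    by apply: injective_projections; rewrite /sc /= -natr1 mulrDl mul1r.
  by rewrite !scS phiD IHn.
exists r.
  (* Additive maps commute with natural multiples, so [r = n] would force [w2 = n], an element of
     [P]. *)
  apply/negP => /(prime_subfieldP p_prime cardF)[n rn].
  case/negP: w2P; apply/(prime_subfieldP p_prime cardF); exists n.
  have [u uE] := phi_surj (1, 0); have := phir u; rewrite rn phin uE /sc /= !mulr1.
  by case.
exists s; first by rewrite s0.
split=> [|q qP rq]; first by rewrite /r mulVKf.
have phiq (m : nat) u : phi (sc (\sum_(i < m) q`_i * r ^+ i) u) = sc (\sum_(i < m) q`_i * w2 ^+ i) (phi u).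
  have phiX i v : phi (sc (r ^+ i) v) = sc (w2 ^+ i) (phi v).
    elim: i v => [|i IHi] v; first by rewrite /sc !mul1r -!surjective_pairing.
    have scX a z : sc (a ^+ i.+1) z = sc (a ^+ i) (sc a z).
      by rewrite /sc /= exprSr !mulrA.
    by rewrite !scX IHi phir.
  elim: m => [|m IHm]; first by rewrite !big_ord0 /sc !mul0r -[RHS]/(0 : F * F) -phi0.
  have scD a b z : sc (a + b) z = sc a z + sc b z.
    by apply: injective_projections; rewrite /sc /= mulrDl.
  have scM a b z : sc (a * b) z = sc a (sc b z) by rewrite /sc /= !mulrA.
  rewrite !big_ord_recr /= !scD phiD IHm; congr (_ + _).
  have /(prime_subfieldP p_prime cardF)[n ->] := qP m.
  by rewrite !scM phin phiX.
(* As [q] kills [r], scaling by [q.[w2]] kills every value of [phi]; the value [(1, 0)] gives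
   [q.[w2] = 0]. *)
have [u uE] := phi_surj (1, 0).
have := phiq (size q) u; rewrite -!horner_coef (rootP rq) uE /sc /= !mul0r mulr0 mulr1.
by rewrite -[(0, 0)]/(0 : F * F) phi0 => -[/esym/rootP].
Qed.

End Isomorphisms.

Local Close Scope ring_scope.

(** * Profiles of the quotients *)

Lemma commg_normal (gT : finGroupType) (G K : {group gT}) g h :
  K <| G -> g \in K -> h \in G -> [~ g, h] \in K.
Proof.
move=> nKG Kg Gh; rewrite commgEl groupM ?groupV // memJ_norm //.
exact: subsetP (normal_norm nKG) h Gh.
Qed.

Section HeisQuotients.
Variables (p e : nat) (F : finFieldType).
Hypothesis p_prime : prime p.
Hypothesis p_gt2 : 2 < p.
Hypothesis e_prime : prime e.
Hypothesis e_gt2 : 2 < e.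
Hypothesis cardF : #|F| = (p ^ e)%N.
Local Notation GL := {'GL_3[F]}.
Local Notation H := (heis F).
Local Notation Z := (hcenter F).

Let two_neq0 : (2%:R != 0 :> F)%R. Proof. exact: odd_pchar_two_neq0 p_prime p_gt2 cardF. Qed.

Lemma card_heis_expn : #|H| = (p ^ (3 * e))%N.
Proof. by rewrite card_heis // cardF -expnM mulnC. Qed.

Lemma heis_pgroup : p.-group H.
Proof. by rewrite /pgroup card_heis_expn pnatX pnat_id. Qed.

Lemma hcenter_normal : Z <| H.
Proof. by apply: subcenter_normal. Qed.

Lemma heis_quotient_hcenter_abelem : p.-abelem (H / Z).
Proof.
apply/abelemP => //; split; first by rewrite sub_der1_abelian // derg1 heis_der.
move=> _ /morphimP[g nZg Hg ->]; rewrite -morphX //; apply: coset_id.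
rewrite mem_hcenter groupX //=.
have -> : hvec (g ^+ p) = (hvec g *+ p)%R.
  elim: (p) => [|n IHn]; first by rewrite expg0 mulr0n -(helt1 F) heltK.
  by rewrite expgS hvecM ?groupX // IHn mulrS.
have pF := card_finPcharP cardF p_prime.
have pairMn (v : F * F) n : (v *+ n = (v.1 *+ n, v.2 *+ n))%R.
  by elim: n => [|n IHn]; rewrite ?mulr0n // !mulrS IHn.
by rewrite pairMn !mulrn_pchar.
Qed.

Section Kernel.
Variable N : {group GL}.
Hypothesis kN : N \in heis_kernels F p e.

Lemma kernel_sub : N \subset Z.
Proof. by move: kN; rewrite inE heis_der // => /andP[]. Qed.

Lemma card_kernel : #|N| = (p ^ (e - 2))%N.
Proof.
move: kN; rewrite inE => /andP[sN /eqP oHN].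
have := Lagrange (subset_trans kernel_sub (hcenter_sub F)); rewrite oHN card_heis_expn.
have -> : (3 * e = (e - 2) + (2 * e + 2))%N.
  by rewrite addnCA subnK 1?ltnW // -mulSnr.
by rewrite [in RHS]expnD => /eqP; rewrite eqn_pmul2r ?expn_gt0 ?prime_gt0 // => /eqP.
Qed.

Lemma kernel_normal : N <| H.
Proof. exact: subcenter_normal kernel_sub. Qed.
End Kernel.

Definition zset (N : {set GL}) : {set F} := [set c | helt 0%R c \in N].

Lemma zsetE (N : {group GL}) : N \subset Z -> N = [set helt 0%R c | c in zset N] :> {set GL}.
Proof.
move=> sN; apply/setP => g; apply/idP/imsetP => [Ng|[c Zc ->]]; last by rewrite inE in Zc.
by have /hcenterP[c Dg] := subsetP sN g Ng; exists c; rewrite // inE -Dg.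
Qed.

Lemma zset_closedD (N : {group GL}) :
  (0 \in zset N)%R /\ {in zset N &, forall x y, x + y \in zset N}%R.
Proof.
split=> [|x y]; rewrite !inE ?helt1 ?group1 // => Nx Ny.
by have := groupM Nx Ny; rewrite heltM // !sympl0 GRing.mul0r !GRing.addr0.
Qed.

Lemma card_zset (N : {group GL}) : N \subset Z -> #|zset N| = #|N|.
Proof. by move=> sN; rewrite [in RHS](zsetE sN) card_imset // => c d /helt_inj[]. Qed.

Definition vset (M : {set GL}) : {set F * F} := [set v | helt v 0%R \in M].

Section Overcenter.
Variable M : {group GL}.
Hypotheses (sM : M \subset H) (sZM : Z \subset M).

Lemma helt_overcenter v c : (helt v c \in M) = (helt v 0%R \in M).
Proof.
have -> : helt v c = helt v 0%R * helt 0%R c.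
  by rewrite heltM // !sympl0 GRing.mul0r !GRing.addr0 GRing.add0r.
by rewrite groupMr // (subsetP sZM) //; apply/hcenterP; exists c.
Qed.

Lemma vsetE : M = hpre (vset M) :> {set GL}.
Proof.
have eqM g : g \in H -> (g \in M) = (hvec g \in vset M).
  by move=> Hg; rewrite inE {1}(heis_heltE Hg) helt_overcenter.
apply/setP => g; apply/idP/setIdP => [Mg|[Hg]]; last by rewrite eqM.
by have Hg := subsetP sM g Mg; rewrite -eqM.
Qed.

Lemma vset_closedD : (0 \in vset M)%R /\ {in vset M &, forall u v, u + v \in vset M}%R.
Proof.
split=> [|u v]; rewrite !inE ?helt1 ?group1 // => Mu Mv.
by have := groupM Mu Mv; rewrite heltM // helt_overcenter.
Qed.

Lemma card_overcenter : #|M| = (#|vset M| * #|F|)%N.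
Proof.
rewrite -[#|F|]cardsT -cardsX.
rewrite -(@card_imset _ _ (fun x : (F * F) * F => helt x.1 x.2)); last first.
  by move=> [u c] [v d] /helt_inj /= [-> ->].
apply: eq_card => g; apply/idP/imsetP => [Mg|[[v c]]].
  have Hg := subsetP sM g Mg; exists (hvec g, hcen g); last exact: heis_heltE.
  by rewrite !inE andbT -(helt_overcenter _ (hcen g)) -heis_heltE.
by rewrite !inE andbT /= => Mv ->; rewrite helt_overcenter.
Qed.

End Overcenter.

Lemma quotient_pgroup (N : {group GL}) : p.-group (H / N).
Proof. exact: morphim_pgroup heis_pgroup. Qed.

Lemma quotient_center_abelem (N : {group GL}) : N \subset Z -> p.-abelem (H / N / (Z / N)).
Proof.
move=> sN; have : H / N / (Z / N) \isog H / Z.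
  by apply: third_isog; rewrite // ?hcenter_normal ?subcenter_normal.
by move/isog_abelem=> ->; apply: heis_quotient_hcenter_abelem.
Qed.

(** A maximal subgroup of a p-group is normal of prime index, so it contains the derived subgroup,
    which is [Z / N]. *)
Lemma center_sub_maximal (N : {group GL}) (M : {group coset_of N}) :
  N \subset Z -> maximal M (H / N) -> Z / N \subset M.
Proof.
move=> sN maxM; have pG := quotient_pgroup N.
have nMG : M <| H / N := p_maximal_normal pG maxM.
have nN : H \subset 'N(N) by apply/normal_norm/subcenter_normal.
rewrite -heis_der // quotientR // -derg1 der1_min ?normal_norm //.
apply/cyclic_abelian/prime_cyclic; rewrite card_quotient ?normal_norm //.
by rewrite (p_maximal_index pG maxM).
Qed.

Lemma maximal_quotientP (N : {group GL}) (M : {group coset_of N}) :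
    N \in heis_kernels F p e -> maximal M (H / N) ->
  exists2 K : {group GL}, (K / N)%G = M &
    [/\ K \subset H, Z \subset K & #|vset K| = (p ^ (2 * e).-1)%N].
Proof.
move=> kN maxM; have nNH := kernel_normal kN; have sN := kernel_sub kN.
pose K := (coset N @*^-1 M)%G; have KM : (K / N)%G = M by apply: group_inj; rewrite /= cosetpreK.
exists K => //; have maxK : maximal K H by rewrite -(quotientGK nNH) cosetpre_maximal.
have sKH := maximal_sub maxK; have sZK : Z \subset K.
  by rewrite -sub_quotient_pre ?center_sub_maximal // (subset_trans (hcenter_sub F)) ?normal_norm.
split=> //; have := Lagrange sKH.
rewrite (p_maximal_index heis_pgroup maxK) card_heis_expn card_overcenter // cardF.
have -> : (3 * e = (2 * e).-1 + e + 1)%N.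
  by rewrite addnAC addn1 prednK ?muln_gt0 ?prime_gt0 // -mulSnr.
rewrite [in RHS]expnD expn1 => /eqP; rewrite eqn_pmul2r ?prime_gt0 // expnD.
by rewrite eqn_pmul2r ?expn_gt0 ?prime_gt0 // => /eqP.
Qed.

Lemma maximal_quotients_isom (N1 N2 : {group GL})
    (M1 : {group coset_of N1}) (M2 : {group coset_of N2}) :
    N1 \in heis_kernels F p e -> N2 \in heis_kernels F p e ->
    maximal M1 (H / N1) -> maximal M2 (H / N2) ->
  exists f : {morphism M1 >-> coset_of N2}, [/\ 'injm f, f @* M1 = M2 & f @* (Z / N1) = Z / N2].
Proof.
move=> kN1 kN2 maxM1 maxM2; have [lam lamD lam0] := exists_functional p_prime cardF e_prime.
have [K1 <- [sK1 sZK1 oK1]] := maximal_quotientP kN1 maxM1.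
have [K2 <- [sK2 sZK2 oK2]] := maximal_quotientP kN2 maxM2.
have [sN1 sN2] := (kernel_sub kN1, kernel_sub kN2).
have [W10 W1D] := vset_closedD sZK1; have [W20 W2D] := vset_closedD sZK2.
have [Z10 Z1D] := zset_closedD N1; have [Z20 Z2D] := zset_closedD N2.
have oZ (N : {group GL}) : N \in heis_kernels F p e -> #|zset N| = (p ^ (e - 2))%N.
  by move=> kN; rewrite card_zset ?card_kernel ?kernel_sub.
have eqv := sympl_equiv_hyperplane p_prime cardF e_prime lamD lam0 W10 W1D oK1 Z10 Z1D (oZ _ kN1)
  W20 W2D oK2 Z20 Z2D (oZ _ kN2).
exact: sympl_equiv_isom (zsetE sN1) (zsetE sN2) (vsetE sK1 sZK1) (vsetE sK2 sZK2) eqv.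
Qed.

Lemma heis_quotient_subgroup_profile (N1 N2 : {group GL}) :
  N1 \in heis_kernels F p e -> N2 \in heis_kernels F p e ->
  same_subgroup_profile (H / N1)%G (H / N2)%G.
Proof.
move=> kN1 kN2; have [sN1 sN2] := (kernel_sub kN1, kernel_sub kN2).
have [nN1 nN2] := (kernel_normal kN1, kernel_normal kN2).
apply: (@same_subgroup_profile_maximal _ _ (H / N1)%G (Z / N1)%G (H / N2)%G (Z / N2)%G p).
- exact/quotient_normal/hcenter_normal.
- exact/quotient_normal/hcenter_normal.
- exact: quotient_center_abelem.
- exact: quotient_center_abelem.
- rewrite /= !card_quotient ?normal_norm //.
  by move: kN1 kN2; rewrite !inE => /andP[_ /eqP->] /andP[_ /eqP->].
- have nZ (N : {group GL}) : N <| H -> Z \subset 'N(N).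
    by move/normal_norm; apply: subset_trans (hcenter_sub F).
  rewrite /= !card_quotient ?nZ // -(divgS sN1) -(divgS sN2).
  by rewrite (card_kernel kN1) (card_kernel kN2).
- by move=> M; apply: center_sub_maximal.
- by move=> M; apply: center_sub_maximal.
by move=> M1 M2; apply: maximal_quotients_isom.
Qed.

(** The commutators of a single element outside [Z] with [H] already fill [Z]. *)
Lemma heis_normal_dichotomy (K : {group GL}) : K <| H -> Z \subset K \/ K \subset Z.
Proof.
move=> nKH; have [sKZ|/subsetPn[g Kg notZ]] := boolP (K \subset Z); [by right | left].
have Hg := subsetP (normal_sub nKH) g Kg.
have v0 : (hvec g != 0)%R by apply: contraNneq notZ => v0; rewrite mem_hcenter Hg v0 eqxx.
apply/subsetP => _ /hcenterP[c ->]; have [u <-] := sympl_surj c v0.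
rewrite -(heltR two_neq0 (hvec g) u (hcen g) 0%R) -(heis_heltE Hg).
exact: (commg_normal nKH Kg (helt_heis u 0%R)).
Qed.

(** The index of [N] in [Z] is [p ^ 2], so anything strictly between has index [p] in [Z]. *)
Lemma proper_between_maximal (N K : {group GL}) : N \in heis_kernels F p e ->
  ((N \proper K) && (K \proper Z)) = ((K \in maximals [group of Z]) && (N \subset K)).
Proof.
move=> kN; have sN := kernel_sub kN; have oN := card_kernel kN.
have pZ : p.-group Z := pgroupS (hcenter_sub F) heis_pgroup.
have oZ : #|Z| = (p ^ e)%N by rewrite card_hcenter.
have e2 : e = (e - 2).+2 by rewrite -addn2 subnK // ltnW.
rewrite inE; apply/andP/andP => [[prNK prKZ]|[maxK sNK]].
  split; last exact: proper_sub.
  have sKZ := proper_sub prKZ; apply: p_index_maximal => //.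
  have [k oK] := p_natP (pgroupS sKZ pZ).
  have := proper_card prNK; have := proper_card prKZ; rewrite oN oK oZ.
  rewrite !ltn_exp2l ?prime_gt1 // => ke ek.
  have {ke ek} Dk : k = e.-1.
    by apply/eqP; rewrite eqn_leq -ltnS prednK ?ke ?prime_gt0 // e2.
  by rewrite -divgS // oZ oK Dk -[in (p ^ e)%N](prednK (prime_gt0 e_prime)) expnS mulnK ?expn_gt0 ?prime_gt0.
split; last exact: (maxgroupp maxK).
have := Lagrange (maximal_sub maxK); rewrite (p_maximal_index pZ maxK) oZ => oK.
rewrite properEcard sNK oN -(ltn_pmul2r (prime_gt0 p_prime)) oK -expnSr.
by rewrite ltn_exp2l ?prime_gt1 //= [X in _ < X]e2.
Qed.

Lemma maximal_center_quotients_isog (K1 K2 : {group GL}) :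
  maximal K1 Z -> maximal K2 Z -> H / K1 \isog H / K2.
Proof.
move=> max1 max2; have [lam lamD lam0] := exists_functional p_prime cardF e_prime.
have [sK1 sK2] := (maximal_sub max1, maximal_sub max2).
have [Z10 Z1D] := zset_closedD K1; have [Z20 Z2D] := zset_closedD K2.
have oK (K : {group GL}) : maximal K Z -> #|zset K| = (p ^ e.-1)%N.
  move=> maxK; rewrite card_zset ?(maximal_sub maxK) //.
  have := Lagrange (maximal_sub maxK).
  rewrite (p_maximal_index (pgroupS (hcenter_sub F) heis_pgroup) maxK) card_hcenter cardF.
  rewrite -{1}(prednK (prime_gt0 e_prime)) expnSr => /eqP.
  by rewrite eqn_pmul2r ?prime_gt0 // => /eqP.
have eqv := sympl_equiv_corank1 p_prime cardF e_prime lamD lam0 Z10 Z1D (oK _ max1) Z20 Z2D (oK _ max2).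
have HE : heis_group F = hpre setT :> {set GL}.
  by apply/setP => g; apply/idP/setIdP => [Hg|[] //]; split=> //; apply: in_setT.
have [f [injf imf _]] := sympl_equiv_isom two_neq0 (zsetE sK1) (zsetE sK2) HE HE eqv.
by apply/isogP; exists f.
Qed.

(** Nontrivial normal subgroups of [H / N] come from normal [K] properly containing [N]. Those above
    [Z] give a count [D] free of [N]; the others are maximal in [Z] and are counted by [B N]. *)
Lemma heis_quotient_quotient_profile (N1 N2 : {group GL}) :
  N1 \in heis_kernels F p e -> N2 \in heis_kernels F p e ->
  same_quotient_profile (H / N1)%G (H / N2)%G.
Proof.
move=> kN1 kN2 rT J.
pose D := #|[set K : {group GL} | [&& K <| H, Z \subset K & H / K \isog J]]|.
pose B (N : {group GL}) := [set K in maximals [group of Z] | (N \subset K) && (H / K \isog J)].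
have count (N : {group GL}) : N \in heis_kernels F p e ->
    #|[set K : {group coset_of N} | [&& K <| H / N, K :!=: 1 & H / N / K \isog J]]| = (D + #|B N|)%N.
  move=> kN; have [sN nN] := (kernel_sub kN, kernel_normal kN).
  transitivity #|[set K : {group GL} | [&& K <| H, N \proper K & H / K \isog J]]|.
    rewrite -[RHS](@card_in_imset _ _ (fun K : {group GL} => K / N)%G); last first.
      move=> K L; rewrite !inE => /and3P[nK /proper_sub sNK _] /and3P[nL /proper_sub sNL _] [eqKL].
      apply: group_inj; apply: (quotient_inj _ _ eqKL).
        exact: normalS sNK (normal_sub nK) nN.
      exact: normalS sNL (normal_sub nL) nN.
    apply: eq_card => M; apply/idP/imsetP => [|[K]]; rewrite !inE.
      case/and3P=> nM; case/(inv_quotientN nN): (nM) => K KM sNK nK.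
      have {KM} <- : (K / N)%G = M by apply: group_inj.
      move=> M1 isoJ; exists K => //; rewrite !inE nK /=; apply/andP; split.
        by rewrite -quotient_neq1 // (normalS sNK (normal_sub nK)).
      by apply: isog_trans isoJ; rewrite isog_sym; apply: third_isog.
    case/and3P=> nK prNK isoJ ->; rewrite quotient_normal //=; apply/andP; split.
      rewrite quotient_neq1 ?prNK //; exact: normalS (proper_sub prNK) (normal_sub nK) nN.
    by apply: isog_trans isoJ; apply: third_isog; rewrite // proper_sub.
  rewrite -(cardsID [set K : {group GL} | Z \subset K]); congr (_ + _)%N.
    apply: eq_card => K; rewrite !inE; case: (K <| H) => //=.
    case sZK: (Z \subset K); rewrite ?andbT ?andbF //=.
    rewrite (_ : N \proper K) //; apply: proper_sub_trans sZK.
    rewrite properEcard sN (card_kernel kN) card_hcenter cardF ltn_exp2l ?prime_gt1 //.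
    by rewrite ltn_subrL /= prime_gt0 ?andbT.
  apply: eq_card => K; rewrite [RHS]in_set -/(maximals _) andbA -proper_between_maximal //.
  rewrite !inE; case isoJ: (H / K \isog J); rewrite ?andbF ?andbT //.
  apply/andP/andP => [[nsZK /andP[nK prNK]]|[prNK prKZ]].
    have [sZK|sKZ] := heis_normal_dichotomy nK; first by rewrite sZK in nsZK.
    by split=> //; rewrite properE sKZ.
  by rewrite proper_subn // prNK subcenter_normal // proper_sub.
rewrite !count //; congr (_ + _)%N.
(* The quotients by maximal subgroups of [Z] are all isomorphic, so either all of them are of type
   [J] or none is; in the first case the count depends only on the order of [Z / N]. *)
have [K0 |noK] := pickP [pred K in maximals [group of Z] | H / K \isog J].
  case/andP; rewrite inE => maxK0 isoJ.
  have BE (N : {group GL}) : N \in heis_kernels F p e -> #|B N| = #|maximals (Z / N)%G|.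
    move=> kN; rewrite card_maximals_quotient; last first.
      exact: normalS (kernel_sub kN) (hcenter_sub F) (kernel_normal kN).
    apply: eq_card => K; rewrite !inE; case maxK: (maximal K Z) => //=.
    have -> : H / K \isog J by apply: isog_trans isoJ; apply: maximal_center_quotients_isog.
    by rewrite andbT.
  have abelZ (N : {group GL}) : p.-abelem (Z / N).
    apply/abelemP => //; split.
      apply: quotient_abelian; apply: abelianS (center_abelian H).
      exact: hcenter_central.
    move=> _ /morphimP[z nN /hcenterP[c Dz] ->]; rewrite -morphX // -[RHS](morph1 (coset_morphism N)).
    congr (coset N _); rewrite {}Dz {z nN}; have -> n : helt 0%R c ^+ n = helt 0%R (c *+ n)%R.
      elim: n => [|n IHn]; first by rewrite expg0 mulr0n helt1.
      by rewrite expgS IHn heltM // sympl0 GRing.mul0r !GRing.addr0 mulrS.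
    by rewrite mulrn_pchar ?helt1 // (card_finPcharP cardF).
  rewrite !BE //; apply: card_maximals_abelem (abelZ N1) (abelZ N2) _.
  have nZ (N : {group GL}) : N <| H -> Z \subset 'N(N).
    by move/normal_norm; apply: subset_trans (hcenter_sub F).
  rewrite /= !card_quotient ?nZ ?kernel_normal // -(divgS (kernel_sub kN1)) -(divgS (kernel_sub kN2)).
  by rewrite (card_kernel kN1) (card_kernel kN2).
have B0 N : B N = set0.
  by apply/setP => K; rewrite !inE andbCA; have := noK K; rewrite !inE => ->; rewrite andbF.
by rewrite !B0.
Qed.

(** [Z / N] is the derived subgroup of the p-group [H / N], hence inside its Frattini subgroup.
    Lifts of a minimal generating set of the elementary abelian quotient, of rank [2 * e], therefore
    generate. *)
Lemma heis_quotient_grank (N : {group GL}) :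
  N \in heis_kernels F p e -> 'm(H / N) = (2 * e)%N.
Proof.
move=> kN; have [sN nN] := (kernel_sub kN, kernel_normal kN).
have nZG : Z / N <| H / N by apply/quotient_normal/hcenter_normal.
have abelQ := quotient_center_abelem sN.
have mQ : 'm(H / N / (Z / N)) = (2 * e)%N.
  rewrite grank_abelian ?(abelem_abelian abelQ) // (rank_abelem abelQ).
  rewrite (card_isog (third_isog _ nN hcenter_normal)) // card_quotient ?normal_norm ?hcenter_normal //.
  rewrite -divgS ?hcenter_sub // card_heis // card_hcenter cardF expnS mulKn ?expn_gt0 ?prime_gt0 //.
  by rewrite -expnM pfactorK // mulnC.
apply/eqP; rewrite eqn_leq -{2}mQ quotient_grank ?normal_norm // andbT.
have [B genB oB] := grank_witness (H / N / (Z / N)).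
pose X := [set repr x | x : coset_of (Z / N) in B].
have sX : X \subset H / N.
  apply/subsetP => _ /imsetP[x Bx ->].
  have : x \in H / N / (Z / N) by rewrite -genB mem_gen.
  case/morphimP=> y nZy Gy Dx; have := mem_repr_coset x.
  rewrite {2}Dx val_coset // => /rcosetP[z Zz ->].
  by rewrite groupM // (subsetP (normal_sub nZG)).
have XB : X / (Z / N) = B.
  apply/setP => x; apply/idP/idP => [/morphimP[y _ /imsetP[b Bb ->] ->]|Bx].
    by rewrite /= coset_reprK.
  rewrite -(coset_reprK x); apply: (mem_morphim (coset_morphism _) (repr_coset_norm x)).
  exact: imset_f.
have genX : <<X>> = H / N.
  apply: Phi_nongen; apply/eqP; rewrite eqEsubset join_subG Phi_sub sX /=.
  have sZP : Z / N \subset 'Phi(H / N).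
    rewrite (Phi_joing (quotient_pgroup N)) (subset_trans _ (joing_subl _ _)) //.
    by rewrite -heis_der // quotientR ?normal_norm // derg1.
  apply: subset_trans (genS (setSU X sZP)).
  have -> : <<Z / N :|: X>> = (Z / N) <*> <<X>> by rewrite joing_idr.
  have nX : <<X>> \subset 'N(Z / N) by rewrite gen_subG (subset_trans sX) ?normal_norm.
  rewrite -(quotientSGK _ (joing_subl _ _)) ?normal_norm // quotientYidl //.
  by rewrite quotient_gen ?(subset_trans sX) ?normal_norm // XB genB.
by rewrite -genX (leq_trans (grank_min X)) // -mQ -oB leq_imset_card.
Qed.

End HeisQuotients.

(** * Counting isomorphism classes *)

Lemma card_bigcup_leq (I T : finType) (D : {set I}) (Y : I -> {set T}) n :
  {in D, forall i, #|Y i| <= n} -> #|\bigcup_(i in D) Y i| <= #|D| * n.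
Proof.
move=> Yn; rewrite -sum_nat_const.
apply: (@leq_trans (\sum_(i in D) #|Y i|)); last exact: leq_sum.
elim/big_rec2: _ => [|i m A _ leAm]; first by rewrite cards0.
by apply: leq_trans (leq_card_setU _ _) _; rewrite leq_add2l.
Qed.

Section Counting.
Variables (p e : nat) (F : finFieldType).
Hypothesis p_prime : prime p.
Hypothesis p_gt2 : 2 < p.
Hypothesis e_prime : prime e.
Hypothesis e_gt2 : 2 < e.
Hypothesis cardF : #|F| = (p ^ e)%N.
Local Notation P := (prime_subfield F p).
Local Notation H := (heis F).

Lemma card_span2 (w : F) : #|span2 p w| <= p ^ 2.
Proof.
rewrite /span2 curry_imset2X (leq_trans (leq_imset_card _ _)) // cardsX.
by rewrite !(card_prime_subfield p_prime cardF).
Qed.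

Lemma span2P (w x : F) :
  reflect (exists a b : nat, x = a%:R + b%:R * w)%R (x \in span2 p w).
Proof.
apply: (iffP imset2P) => [[a b]|[a [b ->]]].
  by move=> /(prime_subfieldP p_prime cardF)[m ->] /(prime_subfieldP p_prime cardF)[n ->] ->; exists m, n.
by exists (a%:R)%R (b%:R)%R => //; apply: natr_prime_subfield p_prime cardF _.
Qed.

Lemma span2_scale (w a x : F) : a \in P -> x \in span2 p w -> (a * x)%R \in span2 p w.
Proof.
move=> /(prime_subfieldP p_prime cardF)[n ->] /span2P[b [c ->]]; apply/span2P.
by exists (n * b)%N, (n * c)%N; rewrite !natrM mulrDr !mulrA.
Qed.

(** Scaling by [P] keeps [d] in the pencil, so [P] lies among the at most [p ^ 2] ratios and its [p]
    elements can be subtracted. *)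
Lemma card_span2_ratio (w d : F) : d \in span2 p w -> d != 0%R ->
  #|[set t / d | t in span2 p w]%R :\: P| <= p ^ 2 - p.
Proof.
move=> Sd d0; rewrite cardsD; set S := [set _ | _ in _].
have sPS : P \subset S.
  apply/subsetP => x Px; apply/imsetP; exists (x * d)%R; last by rewrite mulfK.
  exact: span2_scale.
have /setIidPr -> := sPS; rewrite (card_prime_subfield p_prime cardF) leq_sub2r //.
exact: leq_trans (leq_imset_card _ _) (card_span2 w).
Qed.

(* These r are the images of w under Moebius transformations over P. *)
Definition moebius_set (w : F) : {set F} :=
  [set r in ~: P | [exists s in span2 p w, (s != 0) && (s * r \in span2 p w)]]%R.

(** Up to a factor in [P] the denominator [s] is 1 or [w + a], one of the [p + 1] points of a
    projective line. Each leaves at most [p ^ 2 - p] ratios, and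
    [(p + 1) * (p ^ 2 - p) = p ^ 3 - p]. *)
Lemma card_moebius_set (w : F) : w \notin P -> #|moebius_set w| <= p ^ 3 - p.
Proof.
move=> wP; pose D := 1%R |: [set w + a | a in P]%R.
have PE x : reflect (exists n : nat, x = n%:R%R) (x \in P) := prime_subfieldP p_prime cardF x.
have DS d : d \in D -> (d \in span2 p w) && (d != 0%R).
  case/setU1P => [->|/imsetP[a Pa ->]].
    by rewrite oner_eq0 andbT; apply/span2P; exists 1%N, 0%N; rewrite mulr0n mul0r addr0.
  have /PE[n Dn] := Pa; apply/andP; split.
    by apply/span2P; exists n, 1%N; rewrite mulr1n mul1r addrC Dn.
  apply: contraNneq wP => /eqP; rewrite addr_eq0 => /eqP->.
  exact: prime_subfieldN p_prime cardF _ Pa.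
have oD : #|D| <= p.+1.
  rewrite cardsU1 -add1n leq_add ?leq_b1 // (leq_trans (leq_imset_card _ _)) //.
  by rewrite (card_prime_subfield p_prime cardF).
pose Y d := ([set t / d | t in span2 p w]%R :\: P).
have sub : moebius_set w \subset \bigcup_(d in D) Y d.
  apply/subsetP => r /setIdP[rP /exists_inP[s Ss /andP[s0 Ssr]]]; rewrite inE in rP.
  have /imset2P[a b Pa Pb Ds] := Ss.
  have [b0|b0] := eqVneq b 0%R.
    have a0 : a != 0%R by move: s0; rewrite Ds b0 mul0r addr0.
    apply/bigcupP; exists 1%R; first exact: setU11.
    rewrite inE rP; apply/imsetP; exists (a^-1 * (s * r))%R.
      by rewrite span2_scale ?(prime_subfieldV p_prime cardF).
    by rewrite divr1 Ds b0 mul0r addr0 mulKf.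
  apply/bigcupP; exists (w + b^-1 * a)%R.
    rewrite setU1r ?imset_f //; have /PE[n ->] := prime_subfieldV p_prime cardF Pb.
    have /PE[m ->] := Pa; rewrite -natrM; exact: natr_prime_subfield p_prime cardF _.
  rewrite inE rP; apply/imsetP; exists (b^-1 * (s * r))%R.
    by rewrite span2_scale ?(prime_subfieldV p_prime cardF).
  have -> : s = (b * (w + b^-1 * a))%R by rewrite Ds mulrDr mulVKf // addrC.
  rewrite mulrA mulKf // mulrAC divff ?mul1r //.
  by apply: contraNneq s0 => D0; rewrite Ds -(mulVKf b0 a) addrC -mulrDr D0 mulr0.
apply: leq_trans (subset_leq_card sub) _.
apply: leq_trans (card_bigcup_leq (n := p ^ 2 - p) _) _.
  by move=> d /DS/andP[Sd d0]; apply: card_span2_ratio.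
apply: leq_trans (leq_mul oD (leqnn _)) _.
by rewrite mulnBr !mulSn -expnS mulnn [p ^ 2 + _]addnC subnDr.
Qed.

Lemma card_isog_hker (lam : F -> 'F_p) (w : F) : {morph lam : x y / x + y}%R ->
    (exists x, lam x != 0)%R -> w \notin P ->
  #|[set w2 in ~: P | H / hker lam w \isog H / hker lam w2]| <= (p ^ 3 - p) * e.
Proof.
move=> lamD lam0 wP; have two0 := odd_pchar_two_neq0 p_prime p_gt2 cardF.
have qP (r : F) : {q : {poly F} | [&& q != 0, (size q <= e.+1)%N, root q r & all (mem P) q]}%R.
  apply: sigW; have [q [q0 sq rq qP]] := prime_subfield_annihilator p_prime cardF r.
  exists q; rewrite q0 sq rq /=; apply/(all_nthP 0%R) => i _; exact: qP.
(* The candidates for [w2] arising from one [r]: the roots of a chosen nonzero polynomial over [P]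
   vanishing at [r], at most [e] of them. *)
pose Y r := [set x | root (sval (qP r)) x].
have oY r : #|Y r| <= e.
  rewrite /Y; case: (qP r) => q /= /and4P[q0 sq _ _].
  rewrite -ltnS (leq_trans _ sq) // cardE; apply: max_poly_roots => //.
    by apply/allP => x; rewrite mem_enum inE.
  exact: enum_uniq.
have sub : [set w2 in ~: P | H / hker lam w \isog H / hker lam w2]
    \subset \bigcup_(r in moebius_set w) Y r.
  apply/subsetP => w2 /setIdP[w2P isow]; rewrite inE in w2P.
  have [r rP [s /andP[s0 Ss] [Ssr rootw]]] :=
    isog_hker_root p_prime two0 cardF lamD lam0 wP w2P isow.
  apply/bigcupP; exists r.
    apply/setIdP; split; first by rewrite inE.
    by apply/exists_inP; exists s => //; rewrite s0.
  rewrite inE; case: (qP r) => q /= /and4P[q0 sq rq /(all_nthP 0%R) Pq].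
  apply: rootw => // i; have [/Pq //|iq] := ltnP i (size q).
  by rewrite nth_default // (natr_prime_subfield p_prime cardF 0).
apply: leq_trans (subset_leq_card sub) _.
by apply: leq_trans (leq_mul (card_moebius_set wP) (leqnn e)); apply: card_bigcup_leq.
Qed.

Lemma hker_kernel (lam : F -> 'F_p) (w : F) : {morph lam : x y / x + y}%R ->
  (exists x, lam x != 0)%R -> w \notin P -> hker lam w \in heis_kernels F p e.
Proof.
move=> lamD lam0 wP; have two0 := odd_pchar_two_neq0 p_prime p_gt2 cardF.
have sN := hker_sub two0 lamD w; rewrite inE heis_der // sN /=.
have oN : #|hker lam w| = (p ^ (e - 2))%N.
  rewrite (hkerE two0 lamD) card_imset; last by move=> c d /helt_inj[].
  by have := card_annihilator p_prime cardF e_prime lamD lam0 wP.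
have := Lagrange (subset_trans sN (hcenter_sub F)); rewrite oN (card_heis_expn cardF) => oHN.
rewrite -(eqn_pmul2l (m := p ^ (e - 2))) ?expn_gt0 ?prime_gt0 // oHN -expnD.
by rewrite addnCA subnK 1?ltnW // -mulSnr.
Qed.

(** The [p ^ e - p] parameters [w] outside [P] are sorted by the class of [hker lam w]. A nonempty
    fibre is bounded by [card_isog_hker] applied to any of its members. *)
Lemma card_heis_iso_classes : p ^ e - p <= #|heis_iso_classes F p e| * ((p ^ 3 - p) * e).
Proof.
have [lam lamD lam0] := exists_functional p_prime cardF e_prime.
pose R (N1 N2 : {group {'GL_3[F]}}) := H / N1 \isog H / N2.
have eqR : {in heis_kernels F p e & &, equivalence_rel R}.
  move=> N1 N2 N3 _ _ _; split; first exact: isog_refl.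
  move=> iso12; apply/idP/idP; apply: isog_trans => //.
  by rewrite isog_sym.
have partP := equivalence_partitionP eqR.
have oP : #|~: P| = p ^ e - p by rewrite cardsCs setCK (card_prime_subfield p_prime cardF) cardF.
rewrite -oP -sum1_card.
rewrite (partition_big (fun w => pblock (heis_iso_classes F p e) (hker lam w)) (mem (heis_iso_classes F p e))) /=.
  rewrite -sum_nat_const; apply: leq_sum => C _; rewrite sum1dep_card.
  have [->|[w /setIdP[wP /eqP wC]]] := set_0Vmem [set w in ~: P | pblock (heis_iso_classes F p e) (hker lam w) == C].
    by rewrite cards0.
  rewrite inE in wP.
  apply: leq_trans (subset_leq_card _) (card_isog_hker lamD lam0 wP).
  apply/subsetP => w2 /setIdP[w2P /eqP w2C]; apply/setIdP; split=> //; rewrite inE in w2P.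
  have kw := hker_kernel lamD lam0 wP; have kw2 := hker_kernel lamD lam0 w2P.
  rewrite -[X in is_true X]/(R _ _) -(pblock_equivalence_partition eqR) // -/(heis_iso_classes F p e).
  by rewrite wC -w2C mem_pblock (cover_partition partP).
move=> w; rewrite inE => wP; apply: pblock_mem.
by rewrite (cover_partition partP) hker_kernel.
Qed.

End Counting.

Theorem theorem1p1 (p e : nat) (F : finFieldType)
    (p_prime : prime p) (p_gt2 : 2 < p)
    (e_prime : prime e) (e_gt2 : 2 < e)
    (cardF : #|F| = (p ^ e)%N) :
  [/\ forall N : {group {'GL_3[F]}}, N \in heis_kernels F p e -> N <| heis F,
      forall N1 N2 : {group {'GL_3[F]}},
        N1 \in heis_kernels F p e -> N2 \in heis_kernels F p e ->
        same_subgroup_profile (heis F / N1)%G (heis F / N2)%G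
        /\ same_quotient_profile (heis F / N1)%G (heis F / N2)%G,
      forall N : {group {'GL_3[F]}},
        N \in heis_kernels F p e -> 'm(heis F / N) = (2 * e)%N
    & ((p ^ (e - 3))%N%:R / e%:R <= #|heis_iso_classes F p e|%:R :> rat)%R].
Proof.
split.
- by move=> N; apply: (kernel_normal p_prime p_gt2 cardF).
- move=> N1 N2 kN1 kN2; split; first
    exact: (heis_quotient_subgroup_profile p_prime p_gt2 e_prime e_gt2 cardF kN1 kN2).
  exact: (heis_quotient_quotient_profile p_prime p_gt2 e_prime e_gt2 cardF kN1 kN2).
- by move=> N; apply: (heis_quotient_grank p_prime p_gt2 cardF).
rewrite Num.Theory.ler_pdivrMr ?Num.Theory.ltr0n ?prime_gt0 // -natrM Num.Theory.ler_nat.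
have p3 : 0 < p ^ 3 - p by rewrite subn_gt0 -{1}(expn1 p) ltn_exp2l ?prime_gt1.
rewrite -(leq_pmul2r p3) -mulnA [(e * _)%N]mulnC.
apply: leq_trans (card_heis_iso_classes p_prime p_gt2 e_prime e_gt2 cardF).
(* The product [p ^ (e - 3) * (p ^ 3 - p)] is [p ^ e - p ^ (e - 3) * p], at most [p ^ e - p]. *)
rewrite mulnBr -expnD subnK // leq_sub2l // leq_pmull //.
by rewrite expn_gt0 prime_gt0.
Qed.
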